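(* Consider the finite-horizon stochastic optimal control problem, the functions $f_\theta$, the optimal risk $\mathcal R^*$ and its empirical counterpart $\hat{\mathcal R}^*_n$ described in the context. There is a universal constant $C>0$ such that for any $\epsilon>0$ and $\delta\in(0,1)$, if $$n=\left\lceil C\,\frac{T^3L_C^2}{\epsilon^2}\log\left(\frac{T^2\,\Big[T^6L_C^3L^{T+1}d_{\mathcal A}\log\!\big(T^5L_C^2L^{T+2}/\epsilon^2\big)/\epsilon^3\Big]^{d_{\mathcal S}+d_{\mathcal A}+1}R^{d_{\mathcal S}+d_{\mathcal A}}(L_\Theta R_\Theta/\epsilon)^{d_\Theta}}{\delta}\right)\right\rceil,$$ where inside the logarithms each of the quantities $L_C$, $L$, $R$, $L_\Theta R_\Theta/\epsilon$, $1/\epsilon$ is read as the maximum of itself and $2$, then with probability at least $1-\delta$, $$|\hat{\mathcal R}^*_n(s)-\mathcal R^*(s)|\le\epsilon\qquad\text{for all }s\in\mathcal S_0.$$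
   Context: Stochastic optimal control (SOC) problem: $T$ is a positive integer; for $0\le t\le T$, $\mathcal S_t\subseteq\mathbb R^{d_{\mathcal S}}$ is a state space, $\mathcal A_t\subseteq\mathbb R^{d_{\mathcal A}}$ a control space, $c_t:\mathcal S_t\times\mathcal A_t\to[0,1]$ a cost; for $0\le t\le T-1$, $F_t:\mathcal S_t\times\mathcal A_t\times\Xi_t\to\mathcal S_{t+1}$ is a continuous transition function and the noise $\xi_t\in\Xi_t$ has distribution $P_t$, not depending on state or action; $\xi_0,\dots,\xi_{T-1}$ are independent. $S_{t+1}=F_t(S_t,A_t,\xi_t)$. $\Pi(\mathcal M)$ is the set of randomized history-dependent policies: $A_t\sim\pi(\cdot|H_t)$ with $H_t=\xi_{[t-1]}=(\xi_0,\dots,\xi_{t-1})$. Assumptions on the SOC: each $\mathcal S_t$ and each $\mathcal A_t$ is compact with radius $R$; there is $L>0$ with $|c_t(s,a)-c_t(s',a')|\le L\|(s,a)-(s',a')\|$ and $\|F_t(s,a,\xi)-F_t(s',a',\xi)\|\le L\|(s,a)-(s',a')\|$ for all $s,s'\in\mathcal S_t$, $a,a'\in\mathcal A_t$, $\xi\in\Xi_t$ and all $t$. Norms are Euclidean. Risk: $\mathcal R^\pi(s)=\min_{\theta\in\Theta}\mathbb E^\pi_P[f_\theta(\sum_{t=0}^Tc_t(S_t,A_t))\mid S_0=s]$, with $\Theta\subseteq\mathbb R^{d_\Theta}$, $f_\theta:\mathbb R\to\mathbb R$; $\mathcal R^*(s)=\min_{\pi\in\Pi(\mathcal M)}\mathcal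 R^\pi(s)$. Standing assumption: $|f_\theta(z)-f_\theta(z')|\le L_C|z-z'|$ and $|f_\theta(z)-f_{\theta'}(z)|\le L_\Theta\|\theta-\theta'\|$ for all $z,z'\in[0,T+1]$, $\theta,\theta'\in\Theta$; $\Theta$ is bounded with radius $R_\Theta$. Sampling: for every $0\le t\le T-1$ one draws $n$ i.i.d. samples from $P_t$ (independently over $t$), with empirical distribution $\hat P_{t,n}$. $\hat{\mathcal R}^\pi_n(s)$ is $\mathcal R^\pi(s)$ with $\{P_t\}$ replaced by $\{\hat P_{t,n}\}$, and $\hat{\mathcal R}^*_n(s)=\min_{\pi\in\Pi(\mathcal M)}\hat{\mathcal R}^\pi_n(s)$. *)

(* Defs.v *)
From HB Require Import structures.
From mathcomp Require Import all_boot all_order all_algebra.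
From mathcomp Require Import all_classical all_reals all_analysis.

Set Implicit Arguments.
Unset Strict Implicit.
Unset Printing Implicit Defensive.

Import Order.TTheory GRing.Theory Num.Theory.
Import numFieldNormedType.Exports.
Local Open Scope classical_set_scope.
Local Open Scope ring_scope.

(* The library norm on 'rV[R]_d is the sup norm. *)
Definition enorm (R : realType) (d : nat) (x : 'rV[R]_d) : R :=
  Num.sqrt (\sum_(j < d) x ord0 j ^+ 2).

Definition dist_pair (R : realType) (d1 d2 : nat)
    (s s' : 'rV[R]_d1) (a a' : 'rV[R]_d2) : R :=
  enorm (row_mx s a - row_mx s' a').

(* The centre of the ball is arbitrary. *)
Definition has_radius (R : realType) (d : nat) (A : set 'rV[R]_d) (r : R) :
    Prop :=
  exists x0 : 'rV[R]_d, forall x, A x -> enorm (x - x0) <= r.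

Definition borel (X : ptopologicalType) := g_sigma_algebraType (@open X).

(* Only the times t <= T (spaces, costs) and t < T (noise, transitions) matter.
   The functions [trans t] and [cost t] are total on the ambient vector spaces;
   they are constrained and evaluated only at points of
   [states t] * [controls t]. *)
Record soc (R : realType) (dS dA : nat) := Soc {
  states : nat -> set 'rV[R]_dS;
  controls : nat -> set 'rV[R]_dA;
  noise : nat -> ptopologicalType;
  noise_law : forall t, probability (borel (noise t)) R;
  trans : forall t, 'rV[R]_dS -> 'rV[R]_dA -> noise t -> 'rV[R]_dS;
  cost : nat -> 'rV[R]_dS -> 'rV[R]_dA -> R
}.

Record soc_spec (R : realType) (dS dA : nat) (M : soc R dS dA) (T : nat) :
    Prop := SocSpec {
  states_neq0 : forall t, (t <= T)%N -> states M t !=set0;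
  controls_neq0 : forall t, (t <= T)%N -> controls M t !=set0;
  cost_range : forall t s a, (t <= T)%N -> states M t s -> controls M t a ->
    0 <= cost M t s a <= 1;
  trans_states : forall t s a (x : noise M t), (t < T)%N ->
    states M t s -> controls M t a -> states M t.+1 (trans s a x);
  trans_continuous : forall t, (t < T)%N ->
    {within [set p : 'rV[R]_dS * 'rV[R]_dA * noise M t |
               states M t p.1.1 /\ controls M t p.1.2],
      continuous (fun p => trans p.1.1 p.1.2 p.2)}
}.

Record soc_regular (R : realType) (dS dA : nat) (M : soc R dS dA) (T : nat)
    (rad L : R) : Prop := SocRegular {
  states_compact : forall t, (t <= T)%N -> compact (states M t);
  states_radius : forall t, (t <= T)%N -> has_radius (states M t) rad;
  controls_compact : forall t, (t <= T)%N -> compact (controls M t);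
  controls_radius : forall t, (t <= T)%N -> has_radius (controls M t) rad;
  cost_lipschitz : forall t s s' a a', (t <= T)%N ->
    states M t s -> states M t s' -> controls M t a -> controls M t a' ->
    `|cost M t s a - cost M t s' a'| <= L * dist_pair s s' a a';
  trans_lipschitz : forall t s s' a a' (x : noise M t), (t < T)%N ->
    states M t s -> states M t s' -> controls M t a -> controls M t a' ->
    enorm (trans s a x - trans s' a' x) <= L * dist_pair s s' a a'
}.

Record risk_family (R : realType) (dTh : nat) (Theta : set 'rV[R]_dTh)
    (f : 'rV[R]_dTh -> R -> R) (T : nat) (LC LTh RTh : R) : Prop :=
    RiskFamily {
  Theta_neq0 : Theta !=set0;
  Theta_radius : has_radius Theta RTh;
  risk_lipschitz : forall th z z', Theta th ->
    0 <= z <= T.+1%:R -> 0 <= z' <= T.+1%:R ->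
    `|f th z - f th z'| <= LC * `|z - z'|;
  risk_lipschitz_param : forall th th' z, Theta th -> Theta th' ->
    0 <= z <= T.+1%:R -> `|f th z - f th' z| <= LTh * enorm (th - th')
}.

(* The space of (xi_0, ..., xi_{t-1}), as left-nested pairs with the product
   sigma-algebra; the display is bundled because it depends on t. *)
Fixpoint hist_space (X : nat -> ptopologicalType) (t : nat) :
    {d : measure_display & measurableType d} :=
  match t with
  | 0 => existT _ _ (unit : measurableType _)
  | t'.+1 => existT _ _
      ((projT2 (hist_space X t') * borel (X t'))%type : measurableType _)
  end.

Definition hist (X : nat -> ptopologicalType) (t : nat) :=
  projT2 (hist_space X t).

(* (A_0, ..., A_{t-1}) as left-nested pairs. *)
Fixpoint ctrls (R : realType) (dA t : nat) : Type :=
  if t is t'.+1 then (ctrls R dA t' * 'rV[R]_dA)%type else unit.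

Definition policy (R : realType) (dS dA : nat) (M : soc R dS dA) :=
  forall t, R.-pker (hist (noise M) t) ~> (borel 'rV[R]_dA).

Definition policies (R : realType) (dS dA : nat) (M : soc R dS dA) (T : nat) :
    set (policy M) :=
  [set pol : policy M | forall t (h : hist (noise M) t), (t <= T)%N ->
     pol t h (controls M t) = 1%E].

Arguments policies {R dS dA} M T.

Fixpoint state (R : realType) (dS dA : nat) (M : soc R dS dA)
    (s : 'rV[R]_dS) (t : nat) :
    hist (noise M) t -> ctrls R dA t -> 'rV[R]_dS :=
  match t with
  | 0 => fun _ _ => s
  | t'.+1 => fun h a => trans (state s h.1 a.1) a.2 h.2
  end.

(* c_0(S_0, A_0) + ... + c_{t-1}(S_{t-1}, A_{t-1}) *)
Fixpoint sum_cost (R : realType) (dS dA : nat) (M : soc R dS dA)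
    (s : 'rV[R]_dS) (t : nat) : hist (noise M) t -> ctrls R dA t -> R :=
  match t with
  | 0 => fun _ _ => 0
  | t'.+1 => fun h a =>
      sum_cost s h.1 a.1 + cost M t' (state s h.1 a.1) a.2
  end.

(* Expectation of G(xi_0, ..., xi_{t-1}, A_0, ..., A_{t-1}) when, successively,
   A_i is drawn from pol(. | xi_0, ..., xi_{i-1}) and xi_i from Q_i,
   independently of the past. *)
Fixpoint expect (R : realType) (dS dA : nat) (M : soc R dS dA)
    (Q : forall t, {measure set (borel (noise M t)) -> \bar R})
    (pol : policy M) (t : nat) :
    (hist (noise M) t -> ctrls R dA t -> R) -> R :=
  match t with
  | 0 => fun G => G tt tt
  | t'.+1 => fun G => expect Q pol (fun h a =>
      \int[pol t' h]_(b in controls M t') \int[Q t']_x G (h, x) (a, b))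
  end.

(* E^pol_Q [ g (\sum_(0 <= t <= T) c_t(S_t, A_t)) | S_0 = s ] *)
Definition expected_cost (R : realType) (dS dA : nat) (M : soc R dS dA)
    (T : nat) (Q : forall t, {measure set (borel (noise M t)) -> \bar R})
    (pol : policy M) (g : R -> R) (s : 'rV[R]_dS) : R :=
  expect Q pol (fun (h : hist (noise M) T) (a : ctrls R dA T) =>
    \int[pol T h]_(b in controls M T)
      g (sum_cost s h a + cost M T (state s h a) b)).

(* Theta is not assumed closed, so the minima are taken as infima. *)
Definition risk (R : realType) (dS dA : nat) (M : soc R dS dA) (T : nat)
    (dTh : nat) (Theta : set 'rV[R]_dTh) (f : 'rV[R]_dTh -> R -> R)
    (Q : forall t, {measure set (borel (noise M t)) -> \bar R})
    (pol : policy M) (s : 'rV[R]_dS) : R :=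
  inf [set expected_cost T Q pol (f th) s | th in Theta].

Definition opt_risk (R : realType) (dS dA : nat) (M : soc R dS dA) (T : nat)
    (dTh : nat) (Theta : set 'rV[R]_dTh) (f : 'rV[R]_dTh -> R -> R)
    (Q : forall t, {measure set (borel (noise M t)) -> \bar R})
    (s : 'rV[R]_dS) : R :=
  inf [set risk T Theta f Q pol s | pol in policies M T].

Definition empirical (R : realType) (d : measure_display)
    (X : measurableType d) (n : nat) (x : nat -> X) :
    {measure set X -> \bar R} :=
  mscale (n%:R^-1)%:nng (msum (fun i => \d_(x i)) n).

Record iid_samples (R : realType) (X : nat -> ptopologicalType)
    (P : forall t, probability (borel (X t)) R) (T n : nat)
    (d : measure_display) (Omega : measurableType d)
    (Pr : probability Omega R)
    (xi : forall t, nat -> Omega -> borel (X t)) : Prop := IidSamples {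
  samples_measurable : forall t i, (t < T)%N -> (i < n)%N ->
    measurable_fun [set: Omega] (xi t i);
  samples_law : forall t i (B : set (borel (X t))), (t < T)%N -> (i < n)%N ->
    measurable B -> Pr (xi t i @^-1` B) = P t B;
  samples_indep : forall B : forall t, nat -> set (borel (X t)),
    (forall t i, measurable (B t i)) ->
    Pr [set w | forall t i, (t < T)%N -> (i < n)%N -> B t i (xi t i w)] =
    (\prod_(t < T) \prod_(i < n) Pr (xi t i @^-1` B t i))%E
}.

(* The truncation at 2 applied to the parameters inside the logarithms. *)
Definition max2 (R : realType) (x : R) : R := Num.max x 2.

Definition log_factor (R : realType) (T dS dA dTh : nat)
    (LC L rad LTh RTh eps delta : R) : R :=
  ln (T%:R ^+ 2
      * (T%:R ^+ 6 * max2 LC ^+ 3 * max2 L ^+ (T + 1) * dA%:R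
         * ln (T%:R ^+ 5 * max2 LC ^+ 2 * max2 L ^+ (T + 2)
               * max2 eps^-1 ^+ 2)
         * max2 eps^-1 ^+ 3) ^+ (dS + dA + 1)
      * max2 rad ^+ (dS + dA)
      * max2 (LTh * RTh / eps) ^+ dTh
      / delta).

(* Main.v *)
(* The noise is exogenous, so for a fixed theta and any transition laws Q the
   best policy is given by backward induction: V_T(s, z) is the infimum over a
   of f_theta(z + c_T(s, a)), and V_t(s, z) is the infimum over a of the Q-mean
   of V_{t+1}(F_t(s, a, x), z + c_t(s, a)), where z is the cost accumulated so
   far; the optimal risk is the infimum over theta of V_0(s, 0).

   Summing the worst one-step deviations of the empirical means of V_{t+1} would
   cost T^4 / eps^2 samples. Instead let y be V_{t+1} shifted into [0, B], with B
   of order L_C T, and for lam of order eps / B^2 control the compensated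
   deviation
     +-(P y - Phat y) - 2 lam (Phat y^2 - (P y)^2) <= kap.
   Its exponential moment is at most 1, as the quadratic term pays for the
   variance, so this fails with probability at most exp (- n lam kap / 2). The
   potential V_t +- 2 lam V_t^2 then propagates backwards with an error kap per
   step, and |Vhat_0 - V_0| <= 2 lam B^2 + T kap; with kap of order eps / T this
   takes T^3 L_C^2 / eps^2 samples per unit of logarithmic covering number.

   The union bound runs over nets of the states, controls and accumulated costs
   for every t, and over a net of Theta whose mesh eps / (8 L_Theta) does not
   depend on T, since f_theta is perturbed only once. The Euclidean nets have
   size (c r / eta)^d with an absolute constant c. *)
Require Import Defs.
From mathcomp Require Import all_boot all_order all_algebra.
From mathcomp Require Import all_classical all_reals all_analysis.
From mathcomp Require Import measurable_realfun ring lra.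
Import Order.TTheory GRing.Theory Num.Theory.
Import numFieldNormedType.Exports.
Local Open Scope classical_set_scope.
Local Open Scope ring_scope.
Set Implicit Arguments.
Unset Strict Implicit.
Unset Printing Implicit Defensive.

(** * Integrals of bounded functions *)

(** Two obstacles beyond the sample count shape the proof. The first is measurability. For an
    arbitrary policy the nested integrands of [expect] are not known to be measurable, so the lower
    bound on its cost rests on monotonicity of the integral alone. Near-optimal controls come from a
    bare choice function, so a near-optimal policy is made a Dirac kernel that sees the history only
    through countably many codes of rounded states. The deviation statements quantify over
    uncountably many states and functions, so each is enforced outside a measurable bad event made
    of finitely many rectangles, the only sets on which independence is given.

    The second is dependence: the empirical value functions depend on the samples of all later
    times. Concentration is therefore applied only to the value functions of the true noise laws,
    which are deterministic, and the empirical ones enter through the backward comparison.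

    The absolute constants in the net sizes need no tracking in the formula for [n]: every base
    inside its logarithm is at least 2, so a fixed power of the argument absorbs them, and that
    power becomes a factor of [C]. *)

Section integral_monotone.
Import HBNNSimple.
Context d (X : measurableType d) (R : realType).
Variables (mu : {measure set X -> \bar R}) (D : set X).
Implicit Types f g : X -> \bar R.

(* On a non-measurable function the library's integral is the supremum of the
   integrals of smaller simple functions, so it is still monotone. *)
Lemma ge0_le_lower_integral f g : (forall x, D x -> (0 <= f x)%E) ->
  (forall x, D x -> (f x <= g x)%E) ->
  (\int[mu]_(x in D) f x <= \int[mu]_(x in D) g x)%E.
Proof.
move=> f0 fg; rewrite !(integral_mkcond D).
have f0' x : (0 <= (f \_ D) x)%E by exact: erestrict_ge0.
have fg' x : ((f \_ D) x <= (g \_ D) x)%E.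
  by rewrite /patch; case: ifPn => // /set_mem /fg.
rewrite !ge0_integralTE//; last by move=> x; exact: le_trans (f0' x) (fg' x).
apply: ereal_sup_le => _ [h /= hf <-]; exists h => // x.
exact: le_trans (hf x) (fg' x).
Qed.

Lemma le_lower_integral f g : (forall x, D x -> (f x <= g x)%E) ->
  (\int[mu]_(x in D) f x <= \int[mu]_(x in D) g x)%E.
Proof.
move=> fg; rewrite integralE [leRHS]integralE leeB//.
- apply: ge0_le_lower_integral => // x Dx.
  exact: funepos_le (fun y yD => fg _ (set_mem yD)) _ (mem_set Dx).
- apply: ge0_le_lower_integral => // x Dx.
  exact: funeneg_le (fun y yD => fg _ (set_mem yD)) _ (mem_set Dx).
Qed.

End integral_monotone.

Section Rintegral_prob.
Context d (X : measurableType d) (R : realType).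
Variables (mu : {measure set X -> \bar R}) (D : set X).
Hypotheses (mD : measurable D) (muD : mu D = 1%E).
Implicit Types f g : X -> R.

Lemma integral_cst_prob (c : R) : (\int[mu]_(x in D) c%:E = c%:E)%E.
Proof. by rewrite integral_cst// muD mule1. Qed.

Lemma Rintegral_cst_prob (c : R) : \int[mu]_(x in D) c = c.
Proof. by rewrite /Rintegral integral_cst_prob. Qed.

(** Monotonicity squeezes the integral between those of two constants, so the bound also covers
    non-measurable [f]; this is how the nested integrals of [expect] are controlled. *)
Lemma bounded_integral_itv f m M : (forall x, D x -> m <= f x <= M) ->
  (m%:E <= \int[mu]_(x in D) (f x)%:E <= M%:E)%E.
Proof.
move=> fmM; rewrite -{1}(integral_cst_prob m) -{1}(integral_cst_prob M).
by apply/andP; split; apply: le_lower_integral => x /fmM /andP[? ?];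
  rewrite lee_fin.
Qed.

Lemma bounded_integral_fin_num f m M : (forall x, D x -> m <= f x <= M) ->
  (\int[mu]_(x in D) (f x)%:E)%E \is a fin_num.
Proof.
move=> /bounded_integral_itv /andP[mf fM]; rewrite fin_numE.
by apply/andP; split; apply/eqP => E; move: mf fM; rewrite E.
Qed.

Lemma Rintegral_itv f m M : (forall x, D x -> m <= f x <= M) ->
  m <= \int[mu]_(x in D) f x <= M.
Proof.
move=> fmM; have := bounded_integral_itv fmM.
by rewrite -(fineK (bounded_integral_fin_num fmM)) !lee_fin.
Qed.

Lemma le_Rintegral_bounded f g m M :
  (forall x, D x -> m <= f x <= M) -> (forall x, D x -> m <= g x <= M) ->
  (forall x, D x -> f x <= g x) ->
  \int[mu]_(x in D) f x <= \int[mu]_(x in D) g x.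
Proof.
move=> fb gb fg; apply: fine_le.
- exact: bounded_integral_fin_num fb.
- exact: bounded_integral_fin_num gb.
- by apply: le_lower_integral => x /fg; rewrite lee_fin.
Qed.

Lemma bounded_integrable f m M : measurable_fun D f ->
  (forall x, D x -> m <= f x <= M) -> mu.-integrable D (EFin \o f).
Proof.
move=> mf fb; apply: measurable_bounded_integrable => //.
  by rewrite muD ltry.
exists (`|m| + `|M|); split; first exact: num_real.
move=> B BmM x Dx; have /andP[h1 h2] := fb x Dx; apply: (le_trans _ (ltW BmM)).
rewrite ler_norml; apply/andP; split.
  rewrite opprD; have := ler_norm (- m); rewrite normrN.
  have := normr_ge0 M; lra.
have := ler_norm M; have := normr_ge0 m; lra.
Qed.

End Rintegral_prob.

Section Rintegral_prob2.
Context d (X : measurableType d) (R : realType).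
Variables (mu : {measure set X -> \bar R}).
Hypotheses (muT : mu setT = 1%E).
Implicit Types f g : X -> R.

Lemma RintegralDcst f (c m M : R) : measurable_fun setT f ->
  (forall x, m <= f x <= M) ->
  \int[mu]_x (f x + c) = \int[mu]_x f x + c.
Proof.
move=> mf fb; rewrite RintegralD//=.
- by rewrite Rintegral_cst_prob.
- by apply: (@bounded_integrable _ _ _ _ _ _ _ _ m M).
- by apply: (@bounded_integrable _ _ _ _ _ _ _ _ c c) => // x _; rewrite lexx.
Qed.

Lemma Rintegral_close f g (e m M : R) :
  measurable_fun setT f -> measurable_fun setT g ->
  (forall x, m <= f x <= M) -> (forall x, m <= g x <= M) ->
  (forall x, `|f x - g x| <= e) ->
  `|\int[mu]_x f x - \int[mu]_x g x| <= e.
Proof.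
move=> mf mg fb gb fg.
have e0 : 0 <= e by exact: le_trans (normr_ge0 _) (fg point).
have aux f' g' : measurable_fun setT g' ->
    (forall x, m <= f' x <= M) -> (forall x, m <= g' x <= M) ->
    (forall x, `|f' x - g' x| <= e) -> \int[mu]_x f' x <= \int[mu]_x g' x + e.
  move=> mg' fb' gb' fg'; rewrite -(RintegralDcst _ mg' gb').
  apply: (@le_Rintegral_bounded _ _ _ _ _ _ _ _ _ m (M + e)) => // x _.
  - by have := fb' x; lra.
  - by have := gb' x; lra.
  - by have := fg' x; rewrite ler_norml; lra.
rewrite ler_norml; have := aux f g mg fb gb fg.
have := aux g f mf gb fb (fun x => eq_ind _ (fun y => y <= e) (fg x) _ (distrC _ _)).
lra.
Qed.

End Rintegral_prob2.

Section Rintegral_dirac.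
Context d (X : measurableType d) (R : realType).

(** Since [f] may be non-measurable, it is sandwiched between the functions equal to [f a] at [a]
    and to [m], respectively [M], elsewhere. Both are measurable because [[set a]] is, and both have
    Dirac integral [f a]. *)
Lemma Rintegral_dirac_set1 (D : set X) (a : X) (f : X -> R) (m M : R) :
  measurable D -> measurable [set a] -> D a ->
  (forall x, D x -> m <= f x <= M) ->
  \int[\d_a]_(x in D) f x = f a.
Proof.
move=> mD ma Da fb.
have aD : \d_a D = 1%E :> \bar R by rewrite diracE mem_set.
pose g k x := k + (f a - k) * \1_[set a] x.
have ga k : g k a = f a by rewrite /g indicE mem_set//=; ring.
have gb k x : x <> a -> g k x = k.
  by move=> xa; rewrite /g indicE memNset//=; ring.
have gint k : \int[\d_a]_(x in D) g k x = f a.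
  rewrite /Rintegral integral_dirac//; first by rewrite aD mul1e /= ga.
  apply/measurable_EFinP; apply: measurable_funD => //.
  by apply: measurable_funM => //; exact/measurable_funTS/measurable_indic.
have fab := fb _ Da; have /andP[mf fM] := fab.
have gin k x : m <= k <= M -> m <= g k x <= M.
  by move=> km; have [->|/eqP xa] := eqVneq x a; rewrite ?ga ?gb.
have mM : m <= M by exact: le_trans mf fM.
apply/eqP; rewrite eq_le; apply/andP; split.
- rewrite -[leRHS](gint M).
  apply: (@le_Rintegral_bounded _ _ _ _ _ _ _ _ _ m M) => // x Dx.
    by apply: gin; rewrite mM lexx.
  by have [->|/eqP xa] := eqVneq x a; rewrite ?ga ?gb//; have /andP[] := fb x Dx.
- rewrite -[leLHS](gint m).
  apply: (@le_Rintegral_bounded _ _ _ _ _ _ _ _ _ m M) => // x Dx.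
    by apply: gin; rewrite mM lexx.
  by have [->|/eqP xa] := eqVneq x a; rewrite ?ga ?gb//; have /andP[] := fb x Dx.
Qed.

End Rintegral_dirac.

Section empirical.
Context d (X : measurableType d) (R : realType).

Lemma empirical_setT n (x : nat -> X) : (0 < n)%N ->
  empirical R n x setT = 1%E.
Proof.
move=> n0; rewrite /empirical /= /mscale /= /msum /=.
rewrite (eq_bigr (fun=> 1%E)); last by move=> i _; exact: diracT.
rewrite sumEFin big_const_ord iter_addr_0 -EFinM mulVf//.
by rewrite pnatr_eq0 -lt0n.
Qed.

Lemma Rintegral_empirical n (x : nat -> X) (f : X -> R) :
  measurable_fun setT f -> (forall y, 0 <= f y) ->
  \int[empirical R n x]_y f y = n%:R^-1 * \sum_(i < n) f (x i).
Proof.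
move=> mf f0; have mf' : measurable_fun setT (EFin \o f) by exact/measurable_EFinP.
rewrite /Rintegral ge0_integral_mscale//; last by move=> y _; rewrite lee_fin.
rewrite ge0_integral_measure_sum//; last by move=> y _; rewrite lee_fin.
under eq_bigr do rewrite integral_dirac// diracT mul1e.
by rewrite sumEFin -EFinM.
Qed.

End empirical.

Section borel_continuous.
Context (R : realType) (X : ptopologicalType).

Lemma open_measurable_borel (A : set X) : open A -> measurable (A : set (borel X)).
Proof. by move=> oA; exact: sub_sigma_algebra. Qed.

Lemma closed_measurable_borel (A : set X) :
  closed A -> measurable (A : set (borel X)).
Proof.
move=> cA; rewrite -[A]setCK; apply: measurableC.
by apply: open_measurable_borel; exact/closed_openC.
Qed.

Lemma continuous_measurable_borel (f : X -> R) : continuous f ->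
  measurable_fun setT (f : borel X -> R).
Proof.
move=> /continuousP cf; apply: (measurability _ (RGenOpens.measurableE R)).
move=> _ [_ [a [b ->]] <-]; rewrite setTI.
by apply: open_measurable_borel; apply: cf; exact: interval_open.
Qed.

End borel_continuous.

(** * Euclidean nets *)

Section euclidean_norm.
Context (R : realType).

Lemma enorm_ge0 d (x : 'rV[R]_d) : 0 <= enorm x.
Proof. exact: sqrtr_ge0. Qed.

Lemma enorm_sqr d (x : 'rV[R]_d) : enorm x ^+ 2 = \sum_(j < d) x ord0 j ^+ 2.
Proof. by rewrite sqr_sqrtr// sumr_ge0// => j _; exact: sqr_ge0. Qed.

Lemma enorm0 d : enorm (0 : 'rV[R]_d) = 0.
Proof. by rewrite /enorm big1 ?sqrtr0// => j _; rewrite mxE expr0n. Qed.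

Lemma enormN d (x : 'rV[R]_d) : enorm (- x) = enorm x.
Proof. by rewrite /enorm; under eq_bigr do rewrite mxE sqrrN. Qed.

Lemma enorm_distC d (x y : 'rV[R]_d) : enorm (x - y) = enorm (y - x).
Proof. by rewrite -enormN opprB. Qed.

Lemma CauchySchwarz_sum (d : nat) (x y : 'I_d -> R) :
  (\sum_j x j * y j) ^+ 2 <= (\sum_j x j ^+ 2) * (\sum_j y j ^+ 2).
Proof.
set a := \sum_j x j * y j; set b := \sum_j x j ^+ 2; set c := \sum_j y j ^+ 2.
have b0 : 0 <= b by apply: sumr_ge0 => j _; exact: sqr_ge0.
have quad (u v : R) : 0 <= u ^+ 2 * b - 2 * u * v * a + v ^+ 2 * c.
  rewrite /a /b /c !mulr_sumr -sumrB -big_split/= sumr_ge0// => j _.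
  have -> : u ^+ 2 * x j ^+ 2 - 2 * u * v * (x j * y j) + v ^+ 2 * y j ^+ 2 =
    (u * x j - v * y j) ^+ 2 by ring.
  exact: sqr_ge0.
have [b0'|b0'] := eqVneq b 0.
  have x0 j : x j = 0.
    apply/eqP; rewrite -sqrf_eq0; move: b0' => /eqP.
    rewrite psumr_eq0 => [/allP/(_ j)|i _]; last exact: sqr_ge0.
    by rewrite mem_index_enum => /(_ isT).
  have -> : a = 0 by rewrite /a big1// => j _; rewrite x0 mul0r.
  by rewrite b0' mul0r expr0n.
have b1 : 0 < b by rewrite lt_neqAle eq_sym b0'.
have := quad a b.
rewrite (_ : _ + _ = b * (b * c - a ^+ 2)); last by ring.
by rewrite pmulr_rge0// subr_ge0.
Qed.

Lemma enormD d (x y : 'rV[R]_d) : enorm (x + y) <= enorm x + enorm y.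
Proof.
rewrite -(@ler_pXn2r _ 2)// ?nnegrE ?addr_ge0 ?enorm_ge0//.
rewrite sqrrD !enorm_sqr.
under eq_bigr do rewrite mxE sqrrD.
rewrite !big_split/= lerD2r lerD2l -mulr2n lerMn2r/=.
apply: le_trans (ler_norm _) _.
rewrite -(@ler_pXn2r _ 2)// ?nnegrE ?mulr_ge0 ?enorm_ge0//.
by rewrite real_normK ?num_real// exprMn !enorm_sqr; exact: CauchySchwarz_sum.
Qed.

Lemma enorm_triangle d (y x z : 'rV[R]_d) :
  enorm (x - z) <= enorm (x - y) + enorm (y - z).
Proof. by rewrite (le_trans _ (enormD _ _))// addrA subrK. Qed.

Lemma coord_le_enorm d (x : 'rV[R]_d) j : `|x ord0 j| <= enorm x.
Proof.
rewrite -(@ler_pXn2r _ 2)// ?nnegrE ?enorm_ge0// real_normK ?num_real//.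
rewrite enorm_sqr (bigD1 j)//= lerDl sumr_ge0// => i _; exact: sqr_ge0.
Qed.

Lemma enorm_le_coord d (x : 'rV[R]_d) h : (forall j, `|x ord0 j| <= h) ->
  enorm x <= Num.sqrt d%:R * h.
Proof.
case: d x => [|d] x xh.
  by rewrite sqrtr0 mul0r /enorm big_ord0 sqrtr0.
have h0 : 0 <= h by exact: le_trans (normr_ge0 _) (xh ord0).
rewrite -(@ler_pXn2r _ 2)// ?nnegrE ?mulr_ge0 ?sqrtr_ge0 ?enorm_ge0//.
rewrite exprMn enorm_sqr sqr_sqrtr ?ler0n//.
have -> : d.+1%:R * h ^+ 2 = \sum_(j < d.+1) h ^+ 2.
  by rewrite sumr_const card_ord mulr_natl.
apply: ler_sum => j _; rewrite -(real_normK (num_real _)) lerXn2r ?nnegrE//.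
Qed.

Lemma sum_coord_le_enorm d (x : 'rV[R]_d) :
  \sum_j `|x ord0 j| <= Num.sqrt d%:R * enorm x.
Proof.
rewrite -(@ler_pXn2r _ 2)// ?nnegrE ?mulr_ge0 ?sqrtr_ge0 ?sumr_ge0//.
rewrite exprMn enorm_sqr sqr_sqrtr ?ler0n//.
have := CauchySchwarz_sum (fun=> 1) (fun j => `|x ord0 j|).
rewrite (eq_bigr (fun j => `|x ord0 j|)); last by move=> j _; rewrite mul1r.
move=> /le_trans; apply; rewrite expr1n sumr_const card_ord.
by under eq_bigr do rewrite real_normK ?num_real//.
Qed.

Lemma dist_pair_le d1 d2 (s s' : 'rV[R]_d1) (a a' : 'rV[R]_d2) :
  dist_pair s s' a a' <= enorm (s - s') + enorm (a - a').
Proof.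
rewrite /dist_pair -(@ler_pXn2r _ 2)// ?nnegrE ?addr_ge0 ?enorm_ge0//.
rewrite sqrrD !enorm_sqr opp_row_mx add_row_mx big_split_ord/=.
under eq_bigr do rewrite row_mxEl.
under [X in _ + X <= _]eq_bigr do rewrite row_mxEr.
by rewrite lerD2r lerDl mulrn_wge0// mulr_ge0 ?enorm_ge0.
Qed.

End euclidean_norm.

Section nets.
Context (R : realType).

(** As [exp (1 / rho) >= 1 + 1 / rho], the ratio [u] is at most [rho / (rho + 1)], and the geometric
    series is at most [1 / (1 - u) <= rho + 1]. *)
Lemma sum_exp_le (rho : R) (K : nat) : 0 < rho ->
  \sum_(q < K) expR (- rho^-1) ^+ q <= rho + 1.
Proof.
move=> rho0; set u := expR _.
have u0 : 0 <= u by exact: expR_ge0.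
have u1 : u <= rho / (rho + 1).
  rewrite /u expRN -[leRHS]invf_div lef_pV2 ?posrE ?expR_gt0 ?divr_gt0 ?addr_gt0//.
  apply: le_trans (expR_ge1Dx _).
  by rewrite mulrDl divff ?gt_eqF// mul1r.
have v1 : (rho + 1)^-1 <= 1 - u.
  suff -> : (rho + 1)^-1 = 1 - rho / (rho + 1) by rewrite lerD2l lerN2.
  by field; rewrite gt_eqF ?addr_gt0.
have geo : (\sum_(q < K) u ^+ q) * (1 - u) = 1 - u ^+ K.
  by rewrite -[RHS]opprB subrX1 -mulNr opprB mulrC.
have uK : 0 <= u ^+ K by exact: exprn_ge0.
have S0 : 0 <= \sum_(q < K) u ^+ q by apply: sumr_ge0 => q _; exact: exprn_ge0.
have : (\sum_(q < K) u ^+ q) * (rho + 1)^-1 <= 1.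
  apply: (@le_trans _ _ ((\sum_(q < K) u ^+ q) * (1 - u))).
    by apply: ler_wpM2l.
  by rewrite geo gerBl.
by rewrite ler_pdivrMr ?addr_gt0// mul1r.
Qed.

(* Chernoff-type counting: each admissible code has weight at least [expR (- d)]
   under the product weight [q |-> expR (- q / rho)], whose total mass is at
   most [(2 (rho + 1)) ^ d]. *)
Lemma card_small_codes (d K : nat) (rho : R)
    (C : {set {ffun 'I_d -> bool * 'I_K}}) : 0 < rho ->
  (forall c, c \in C -> \sum_j ((c j).2 : nat)%:R <= d%:R * rho) ->
  #|C|%:R <= (2 * expR 1 * (rho + 1)) ^+ d.
Proof.
move=> rho0 CS; set u := expR (- rho^-1).
have u0 : 0 <= u by exact: expR_ge0.
pose w (c : {ffun 'I_d -> bool * 'I_K}) := \prod_j u ^+ (c j).2.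
have w0 c : 0 <= w c by apply: prodr_ge0 => j _; exact: exprn_ge0.
have wC c : c \in C -> expR (- d%:R) <= w c.
  move=> /CS cS; rewrite /w prodrXr -expRM_natr ler_expR natr_sum.
  by rewrite mulNr lerN2 ler_pdivrMl// mulrC.
have -> : #|C|%:R = expR d%:R * \sum_(c in C) expR (- d%:R) :> R.
  by rewrite sumr_const mulrnAr expRxMexpNx_1.
have le1 : \sum_(c in C) expR (- d%:R) <= \sum_c w c.
  apply: (@le_trans _ _ (\sum_(c in C) w c)); first exact: ler_sum.
  rewrite [leRHS](bigID (mem C))/= lerDl; exact: sumr_ge0.
have -> : (2 * expR 1 * (rho + 1)) ^+ d = expR d%:R * (2 * (rho + 1)) ^+ d.
  by rewrite -[in expR d%:R](mul1r d%:R) expRM_natr -exprMn; congr (_ ^+ _); ring.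
rewrite ler_wpM2l ?expR_ge0//; apply: le_trans le1 _.
rewrite /w -(bigA_distr_bigA (fun j (p : bool * 'I_K) => u ^+ p.2)).
rewrite big_const_ord iter_mulr_1 lerXn2r ?nnegrE//.
- by apply: sumr_ge0 => p _; exact: exprn_ge0.
- by rewrite mulr_ge0// addr_ge0// ltW.
rewrite -(pair_bigA _ (fun (b : bool) (q : 'I_K) => u ^+ q))/= sumr_const card_bool.
by rewrite mulr_natl lerMn2r/=; exact: sum_exp_le.
Qed.

(** Cells of side [h = eta / sqrt d] have diameter [eta], but counting all those of the bounding
    cube would put [sqrt d] into the base. A cell is coded by the sign and the truncated size of
    each coordinate. By Cauchy-Schwarz the sizes met by the ball sum to at most
    [sqrt d * r / h = d * (r / eta)], so [card_small_codes] applies with a dimension-free [rho].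
    Each occupied cell is represented by one of its points in [A], so the net stays inside [A]. *)
Lemma euclidean_net d (A : set 'rV[R]_d) (r eta : R) : A !=set0 ->
  has_radius A r -> 0 < eta ->
  exists s : seq 'rV[R]_d,
    [/\ forall y, y \in s -> A y,
        (size s)%:R <= (2 * expR 1 * (r / eta + 2)) ^+ d &
        forall x, A x -> exists2 y, y \in s & enorm (x - y) <= eta].
Proof.
move=> [a Aa] [x0 Ar] eta0.
have r0 : 0 <= r by exact: le_trans (enorm_ge0 _) (Ar _ Aa).
case: d A a Aa x0 Ar => [|d] A a Aa x0 Ar.
  exists [:: a]; split => //.
  - by move=> y; rewrite inE => /eqP ->.
  - move=> x Ax; exists a; first by rewrite mem_head.
    by rewrite /enorm big_ord0 sqrtr0 ltW.
pose h := eta / Num.sqrt d.+1%:R.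
have sd0 : 0 < Num.sqrt (d.+1%:R : R) by rewrite sqrtr_gt0 ltr0n.
have h0 : 0 < h by rewrite divr_gt0.
pose q (x : 'rV[R]_d.+1) j := Num.truncn (`|(x - x0) ord0 j| / h).
pose K := (Num.truncn (r / h)).+1.
have qK x j : A x -> (q x j < K)%N.
  move=> Ax; rewrite /K ltnS; apply: le_truncn.
  by rewrite ler_pM2r ?invr_gt0//; exact: le_trans (coord_le_enorm _ _) (Ar _ Ax).
have qle x j : (q x j)%:R <= `|(x - x0) ord0 j| / h.
  by rewrite truncn_le// divr_ge0// ltW.
pose code (x : 'rV[R]_d.+1) : {ffun 'I_d.+1 -> bool * 'I_K} :=
  [ffun j => (0 <= (x - x0) ord0 j, inord (q x j))].
pose C := [set c | `[< exists2 x, A x & code x = c >]]%SET.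
have /boolp.choice[rep repP] (c : {ffun 'I_d.+1 -> bool * 'I_K}) :
    exists x, c \in C -> A x /\ code x = c.
  have [|cC] := boolP (c \in C).
    by rewrite inE => /asboolP[x Ax xc]; exists x.
  by exists a.
exists [seq rep c | c <- enum C]; split.
- by move=> y /mapP[c]; rewrite mem_enum => /repP[? _] ->.
- rewrite size_map -cardE.
  (* Taking [rho = r / eta + 1] instead of [r / eta] keeps [rho] positive when [r = 0]. *)
  have -> : r / eta + 2 = (r / eta + 1) + 1 by ring.
  apply: card_small_codes; first by rewrite ltr_wpDl ?divr_ge0// ltW.
  move=> c; rewrite inE => /asboolP[x Ax <-].
  apply: (@le_trans _ _ (\sum_j `|(x - x0) ord0 j| / h)).
    by apply: ler_sum => j _; rewrite ffunE/= inordK ?qK.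
  rewrite -mulr_suml ler_pdivrMr//.
  apply: le_trans (sum_coord_le_enorm _) _.
  apply: (@le_trans _ _ (Num.sqrt d.+1%:R * r)).
    by rewrite ler_pM2l//; exact: Ar.
  have -> : d.+1%:R * (r / eta + 1) * h = Num.sqrt d.+1%:R * (r + eta).
    have E := @sqr_sqrtr _ (d.+1%:R : R) (ler0n _ _).
    move: sd0 E; rewrite /h; set sig := Num.sqrt _ => sd0 <-.
    by field; rewrite !gt_eqF.
  by rewrite ler_pM2l// lerDl ltW.
- move=> x Ax; have xC : code x \in C.
    by rewrite inE; apply/asboolP; exists x.
  have [Ay yx] := repP _ xC.
  exists (rep (code x)); first by apply: map_f; rewrite mem_enum.
  move: (rep _) Ay yx => y Ay yx.
  have -> : eta = Num.sqrt d.+1%:R * h by rewrite /h mulrC divfK// gt_eqF.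
  apply: enorm_le_coord => j; clearbody h.
  move: yx => /ffunP/(_ j); rewrite !ffunE => -[sg /(congr1 val)].
  rewrite /= !inordK ?qK// => qq.
  have qub z : `|(z - x0) ord0 j| / h < (q z j)%:R + 1.
    by rewrite natr1 truncnS_gt.
  have -> : (x - y) ord0 j = (x - x0) ord0 j - (y - x0) ord0 j.
    by rewrite !mxE; ring.
  have := qub x; have := qub y; have := qle x j; have := qle y j.
  rewrite qq; move: sg; set a1 := (x - x0) ord0 j; set b1 := (y - x0) ord0 j.
  rewrite !ler_pdivlMr// !ltr_pdivrMr// => sg; rewrite mulrDl mul1r.
  case: (leP 0 b1) sg => hb /esym ha.
    rewrite (ger0_norm ha) (ger0_norm hb) ler_norml; lra.
  have {}ha : a1 < 0 by rewrite real_ltNge ?num_real// ha.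
  rewrite (ltr0_norm ha) (ltr0_norm hb) ler_norml; lra.
Qed.

End nets.

(** * Compensated concentration over i.i.d. samples *)

Section finite_chernoff.
Context (R : realType).

(* With [y = v - m], the exponent is [u = - c y - (lam y)^2], and
   [expR u <= (1 - u)^-1 <= 1 - c y]: the quadratic compensation makes the
   exponential moment at most 1 without any variance term. *)
Lemma compensated_exp_le (B lam m v sg : R) : 0 < lam -> lam * B <= 16^-1 ->
  0 <= m <= B -> 0 <= v <= B -> `|sg| <= 1 ->
  expR (lam / 2 * (sg * (m - v) - 2 * lam * (v ^+ 2 - m ^+ 2))) <=
  1 - lam / 2 * (sg + 4 * lam * m) * (v - m).
Proof.
move=> lam0 lamB /andP[m0 mB] /andP[v0 vB]; rewrite ler_norml => /andP[sg1 sg2].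
set y := v - m; set c := lam / 2 * (sg + 4 * lam * m).
set u := lam / 2 * _.
have uE : u = - (c * y) - lam ^+ 2 * y ^+ 2 by rewrite /u /c /y; field.
have yB : - B <= y <= B by rewrite /y; lra.
have lm : 0 <= lam * m <= 16^-1.
  rewrite mulr_ge0 ?(ltW lam0)//=; apply: le_trans lamB.
  by rewrite ler_pM2l.
have cl : - (5 / 8 * lam) <= c <= 5 / 8 * lam by rewrite /c; nra.
have ly : - 16^-1 <= lam * y <= 16^-1.
  have /andP[? ?] := yB.
  have : lam * y <= lam * B by rewrite ler_pM2l.
  have : lam * - B <= lam * y by rewrite ler_pM2l.
  rewrite mulrN; lra.
have cy : - (5 / 128) <= c * y <= 5 / 128.
  have e : c * y = (c / lam) * (lam * y) by field; rewrite gt_eqF.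
  have : - (5 / 8) <= c / lam <= 5 / 8.
    by rewrite ler_pdivlMr// ler_pdivrMr// mulNr.
  rewrite e; move: (c / lam) (lam * y) ly => a b; nra.
have u1 : 0 < 1 - u.
  by rewrite uE; have := sqr_ge0 (lam * y); rewrite exprMn; lra.
have eu : expR u <= (1 - u)^-1.
  rewrite -[u]opprK expRN opprK lef_pV2 ?posrE ?expR_gt0//.
  by have := expR_ge1Dx (- u).
apply: le_trans eu _; rewrite -[leLHS]mul1r ler_pdivrMr// uE.
have -> : (1 - c * y) * (1 - (- (c * y) - lam ^+ 2 * y ^+ 2)) =
   1 + y ^+ 2 * (lam ^+ 2 - c ^+ 2 - lam ^+ 2 * (c * y)) by ring.
rewrite lerDl mulr_ge0 ?sqr_ge0//.
(* From [lam * B <= 1/16] come [|c| <= 5/8 lam] and [c * y <= 5/128], so the bracket is at least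
   [(1 - 25/64 - 5/128) lam^2 >= 0]. *)
have : c ^+ 2 <= 25 / 64 * lam ^+ 2 by nra.
have : lam ^+ 2 * (c * y) <= lam ^+ 2 * (5 / 128).
  by rewrite ler_wpM2l ?sqr_ge0//; case/andP: cy.
by have := sqr_ge0 lam; lra.
Qed.

(** The pointwise bound [1 - c (v - m)] is affine in [v], and its linear part has mean zero. *)
Lemma compensated_moment_le1 (K : finType) (p v : K -> R) (B lam sg m : R) :
  (forall k, 0 <= p k) -> \sum_k p k = 1 -> 0 < lam -> lam * B <= 16^-1 ->
  (forall k, 0 <= v k <= B) -> `|sg| <= 1 ->
  m = \sum_k p k * v k ->
  \sum_k p k * expR (lam / 2 *
    (sg * (m - v k) - 2 * lam * (v k ^+ 2 - m ^+ 2))) <= 1.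
Proof.
move=> p0 p1 lam0 lamB vB sg1 mE.
have mB : 0 <= m <= B.
  rewrite mE sumr_ge0/= => [|k _]; last by have /andP[? _] := vB k; rewrite mulr_ge0.
  rewrite -[leRHS]mul1r -p1 mulr_suml; apply: ler_sum => k _.
  by rewrite ler_wpM2l//; have /andP[] := vB k.
pose c := lam / 2 * (sg + 4 * lam * m).
apply: (@le_trans _ _ (\sum_k p k * (1 - c * (v k - m)))).
  by apply: ler_sum => k _; rewrite ler_wpM2l//; exact: (@compensated_exp_le B).
rewrite (eq_bigr (fun k => p k - c * (p k * v k) + c * (p k * m))); last first.
  by move=> k _; ring.
rewrite big_split sumrB/= -!mulr_sumr -mulr_suml p1 mul1r -mE; lra.
Qed.

(** Exponential Markov inequality on the product space of codes; exchanging product and sum factors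
    the moment into [n] copies of a quantity at most 1. *)
Lemma finite_chernoff (K : finType) (p u : K -> R) (n : nat) (tau : R)
    (C : {set {ffun 'I_n -> K}}) :
  (forall k, 0 <= p k) -> \sum_k p k * expR (u k) <= 1 ->
  (forall phi, phi \in C -> tau <= \sum_i u (phi i)) ->
  \sum_(phi in C) \prod_i p (phi i) <= expR (- tau).
Proof.
move=> p0 pu Cu.
apply: (@le_trans _ _ (\sum_(phi in C)
    expR (- tau) * \prod_i (p (phi i) * expR (u (phi i))))).
  apply: ler_sum => phi /Cu; rewrite big_split/= -expR_sum mulrCA => h.
  rewrite -expRD -[leLHS]mulr1 ler_wpM2l ?prodr_ge0// -expR0 ler_expR; lra.
rewrite -mulr_sumr -[leRHS]mulr1 ler_wpM2l ?expR_ge0//.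
apply: (@le_trans _ _ (\sum_(phi : {ffun 'I_n -> K})
    \prod_i (p (phi i) * expR (u (phi i))))).
  rewrite [leRHS](bigID (mem C))/= lerDl; apply: sumr_ge0 => phi _.
  by apply: prodr_ge0 => i _; rewrite mulr_ge0 ?expR_ge0.
rewrite -(bigA_distr_bigA (fun (i : 'I_n) k => p k * expR (u k))).
rewrite big_const_ord iter_mulr_1 exprn_ile1//.
by apply: sumr_ge0 => k _; rewrite mulr_ge0 ?expR_ge0.
Qed.

End finite_chernoff.

(** * Independence of the samples drawn at one time *)

Section one_time.
Context (R : realType) (X : nat -> ptopologicalType)
  (P : forall t, probability (borel (X t)) R) (T n : nat)
  (d : measure_display) (Omega : measurableType d) (Pr : probability Omega R)
  (xi : forall t, nat -> Omega -> borel (X t)).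
Hypothesis xiP : iid_samples P T n Pr xi.
Variable (t : nat).
Hypothesis tT : (t < T)%N.

(** The type [X t] depends on [t], so placing the sets [A] at time [t] needs a transport along an
    equality of times. All other times receive [setT], hence contribute factors 1 to the joint
    independence. *)
Let at_time (A : nat -> set (borel (X t))) (t' : nat) (i : nat) :
    set (borel (X t')) :=
  match PeanoNat.Nat.eq_dec t t' with
  | left e => match e in _ = t'' return set (borel (X t'')) with
              | erefl => A i end
  | right _ => setT
  end.

Local Arguments at_time : clear implicits.

Let at_timeE A : at_time A t = A.
Proof.
rewrite /at_time; case: PeanoNat.Nat.eq_dec => // e.
by rewrite (eq_irrelevance e erefl).
Qed.

Let at_time_neq A t' : t' <> t -> at_time A t' = fun=> setT.
Proof.
by move=> tt'; rewrite /at_time; case: PeanoNat.Nat.eq_dec => // e; case: tt'.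
Qed.

Let at_time_measurable A : (forall i, measurable (A i)) ->
  forall t' i, measurable (at_time A t' i).
Proof.
move=> mA t' i; rewrite /at_time; case: PeanoNat.Nat.eq_dec => // e.
by case: t' / e.
Qed.

Lemma samples_rect (A : nat -> set (borel (X t))) :
  (forall i, measurable (A i)) ->
  Pr [set w | forall i, (i < n)%N -> A i (xi t i w)] =
  (\prod_(i < n) P t (A i))%E.
Proof.
move=> mA.
have -> : [set w | forall i, (i < n)%N -> A i (xi t i w)] =
    [set w | forall t' i, (t' < T)%N -> (i < n)%N -> at_time A t' i (xi t' i w)].
  apply/seteqP; split => w /= h.
  - move=> t' i t'T ni; have [e|/eqP ne] := eqVneq t' t.
      by rewrite e at_timeE; exact: h.
    by rewrite at_time_neq.
  - by move=> i ni; have := h t i tT ni; rewrite at_timeE.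
rewrite (samples_indep xiP); last exact: at_time_measurable.
rewrite (bigD1 (Ordinal tT))//= [X in (_ * X)%E]big1 ?mule1.
  apply: eq_bigr => i _; rewrite at_timeE (samples_law xiP)//.
move=> t' /eqP/= ne; rewrite big1// => i _.
rewrite at_time_neq ?preimage_setT ?probability_setT// => e.
by apply: ne; exact: val_inj.
Qed.

Lemma samples_rect_measurable (A : nat -> set (borel (X t))) :
  (forall i, measurable (A i)) ->
  measurable [set w | forall i, (i < n)%N -> A i (xi t i w)].
Proof.
move=> mA.
have -> : [set w | forall i, (i < n)%N -> A i (xi t i w)] =
    \bigcap_(i in `I_n) (xi t i @^-1` A i).
  by apply/seteqP; split => w h i ni; exact: h.
apply: bigcap_measurableType => // i ni; rewrite -[X in measurable X]setTI.
exact: (samples_measurable xiP).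
Qed.

(** Independence is available on rectangles only. Once the samples are reduced to finitely many
    codes, each code vector describes a rectangle, and the event is a finite union of them. *)
Lemma samples_codes (K : finType) (k : X t -> K)
    (C : {set {ffun 'I_n -> K}}) :
  (forall j, measurable (k @^-1` [set j] : set (borel (X t)))) ->
  exists E : set Omega,
   [/\ measurable E,
       (Pr E <= (\sum_(phi in C) \prod_i fine (P t (k @^-1` [set phi i])))%:E)%E
     & forall w, [ffun i : 'I_n => k (xi t i w)] \in C -> E w].
Proof.
move=> mk.
pose A (phi : {ffun 'I_n -> K}) (i : nat) : set (borel (X t)) :=
  if insub i is Some j then k @^-1` [set phi j] else setT.
have mA phi i : measurable (A phi i) by rewrite /A; case: insub.
pose rect phi := [set w | forall i, (i < n)%N -> A phi i (xi t i w)].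
have [mE PE] : measurable (\big[setU/set0]_(phi in C) rect phi) /\
    (Pr (\big[setU/set0]_(phi in C) rect phi) <=
     (\sum_(phi in C) \prod_i fine (P t (k @^-1` [set phi i])))%:E)%E.
  apply: (big_ind2 (fun E x => measurable E /\ (Pr E <= x%:E)%E)).
  - by split; [exact: measurable0 | rewrite measure0].
  - move=> E1 x1 E2 x2 [m1 h1] [m2 h2]; split; first exact: measurableU.
    by rewrite EFinD (le_trans (measureU2 _ _ _))// leeD.
  - move=> phi _; split; first exact: samples_rect_measurable.
    rewrite /rect samples_rect// -prodEFin le_eqVlt; apply/orP; left; apply/eqP.
    apply: eq_bigr => i _; rewrite /A valK fineK//.
    exact: fin_num_measure.
exists (\big[setU/set0]_(phi in C) rect phi); split => // w Cw.
rewrite (bigD1 _ Cw)/=; left => i ni.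
by rewrite /A (insubT (fun i => i < n)%N ni)/= ffunE.
Qed.

End one_time.

Section finite_codes.
Context d (X : measurableType d) (R : realType) (K : finType) (k : X -> K).
Hypothesis mk : forall j, measurable (k @^-1` [set j]).

Lemma codes_indic (v : K -> R) x :
  v (k x) = \sum_j v j * \1_(k @^-1` [set j]) x.
Proof.
rewrite (bigD1 (k x))//= indicE mem_set//= mulr1 big1 ?addr0// => j jk.
rewrite indicE memNset ?mulr0//= => e.
by move: jk; rewrite e eqxx.
Qed.

Lemma measurable_codes (v : K -> R) : measurable_fun setT (v \o k).
Proof.
rewrite (_ : v \o k = fun x => \sum_j v j * \1_(k @^-1` [set j]) x); last first.
  by apply/funext => x; exact: codes_indic.
by apply: measurable_sum => j; apply: measurable_funM => //; exact: measurable_indic.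
Qed.

Lemma Rintegral_codes (mu : {measure set X -> \bar R}) (v : K -> R) :
  mu setT = 1%E -> (forall j, 0 <= v j) ->
  \int[mu]_x v (k x) = \sum_j fine (mu (k @^-1` [set j])) * v j.
Proof.
move=> mu1 v0.
have mufin j : mu (k @^-1` [set j]) \is a fin_num.
  rewrite ge0_fin_numE//; apply: (@le_lt_trans _ _ (mu setT)); last by rewrite mu1 ltry.
  by apply: le_measure; rewrite ?inE//; exact: mk.
rewrite (_ : (fun x => v (k x)) = fun x => \sum_j v j * \1_(k @^-1` [set j]) x).
  rewrite /Rintegral.
  under eq_integral do rewrite -sumEFin.
  rewrite ge0_integral_sum//.
  - under eq_bigr => j _.
      under eq_integral do rewrite EFinM.
      rewrite ge0_integralZl_EFin//; last first.
        by apply/measurable_EFinP; exact: measurable_indic.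
      rewrite integral_indic// setIT.
      rewrite -(fineK (mufin j)) -EFinM.
      over.
    by rewrite sumEFin/=; apply: eq_bigr => j _; rewrite mulrC.
  - move=> j; apply/measurable_EFinP.
    by apply: measurable_funM => //; exact: measurable_indic.
  - by move=> j x _; rewrite lee_fin mulr_ge0// indicE.
by apply/funext => x; exact: codes_indic.
Qed.

End finite_codes.

Lemma sum_deviation (R : realType) (n : nat) (sg m lam : R) (a : 'I_n -> R) :
  (0 < n)%N ->
  \sum_i (sg * (m - a i) - 2 * lam * (a i ^+ 2 - m ^+ 2)) =
  n%:R * (sg * (m - n%:R^-1 * \sum_i a i)
    - 2 * lam * (n%:R^-1 * (\sum_i a i ^+ 2) - m ^+ 2)).
Proof.
move=> n0; have nR0 : n%:R != 0 :> R by rewrite pnatr_eq0 -lt0n.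
rewrite (_ : \sum_i _ = sg * (\sum_(i < n) m - \sum_i a i)
  - 2 * lam * (\sum_i a i ^+ 2 - \sum_(i < n) m ^+ 2)); last first.
  by rewrite -!sumrB !mulr_sumr -sumrB.
rewrite !sumr_const card_ord -[m *+ n]mulr_natl -[_ ^+ 2 *+ n]mulr_natl.
by field.
Qed.

Section deviation.
Context (R : realType) (X : nat -> ptopologicalType)
  (P : forall t, probability (borel (X t)) R) (T n : nat)
  (d : measure_display) (Omega : measurableType d) (Pr : probability Omega R)
  (xi : forall t, nat -> Omega -> borel (X t)).
Hypotheses (xiP : iid_samples P T n Pr xi) (n0 : (0 < n)%N).
Variables (t : nat) (y : borel (X t) -> R) (B eta lam kap : R).
Hypotheses (tT : (t < T)%N) (eta0 : 0 < eta) (lam0 : 0 < lam)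
  (lamB : lam * B <= 16^-1).
Hypotheses (my : measurable_fun setT y) (yB : forall x, 0 <= y x <= B).

Let Phat w := empirical R n (fun i => xi t i w).

Let B0 : 0 <= B.
Proof. by have /andP[/le_trans] := yB point; apply. Qed.

(** Rounding [y] down to multiples of [eta] makes it finite-valued, so [finite_chernoff] applies
    with exponent [lam / 2] times the compensated deviation. A single event [E] then serves all [y']
    near [y], which the net argument requires. Each such [y'] is within [2 eta] of the rounded
    function: the linear terms cost [4 eta], the quadratic ones [eta]. *)
Lemma sample_deviation1 (sg : R) : `|sg| <= 1 ->
  exists E : set Omega,
  [/\ measurable E, (Pr E <= (expR (- (n%:R * lam * kap / 2)))%:E)%E &
   forall w, ~ E w -> forall y' : borel (X t) -> R, measurable_fun setT y' ->
     (forall x, 0 <= y' x <= B) -> (forall x, `|y' x - y x| <= eta) ->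
     sg * (\int[P t]_x y' x - \int[Phat w]_x y' x)
       - 2 * lam * (\int[Phat w]_x (y' x ^+ 2) - (\int[P t]_x y' x) ^+ 2)
     <= kap + 5 * eta].
Proof.
move=> sg1.
pose K := (Num.truncn (B / eta)).+1.
have q0 x : 0 <= y x / eta by rewrite divr_ge0 ?(ltW eta0)//; have /andP[] := yB x.
have qK x : (Num.truncn (y x / eta) < K)%N.
  by rewrite ltnS le_truncn// ler_pM2r ?invr_gt0//; have /andP[] := yB x.
pose k (x : borel (X t)) : 'I_K := inord (Num.truncn (y x / eta)).
pose v (j : 'I_K) : R := j%:R * eta.
have vB j : 0 <= v j <= B.
  rewrite mulr_ge0//= ?(ltW eta0)// -ler_pdivlMr//.
  apply: (@le_trans _ _ (Num.truncn (B / eta))%:R).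
    by rewrite ler_nat -ltnS.
  by rewrite truncn_le// divr_ge0// ltW.
have vk x : v (k x) <= y x < v (k x) + eta.
  rewrite /v /k inordK//; apply/andP; split.
    by rewrite -ler_pdivlMr// truncn_le.
  by rewrite -[X in _ + X]mul1r -mulrDl -ltr_pdivrMr// natr1 truncnS_gt.
have mk j : measurable (k @^-1` [set j]).
  rewrite (_ : _ @^-1` _ = y @^-1` `[v j, v j + eta[%classic); last first.
    apply/seteqP; split => x /=; rewrite in_itv/=.
      by move=> <-; exact: vk.
    move=> h; apply/val_inj; rewrite /k/= inordK//.
    apply: truncn_def; rewrite ler_pdivlMr// ltr_pdivrMr// -natr1 mulrDl mul1r.
    exact: h.
  by rewrite -[X in measurable X]setTI; apply: my.
pose p j : R := fine (P t (k @^-1` [set j])).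
have p0 j : 0 <= p j by rewrite fine_ge0.
have PtT : P t setT = 1%E by exact: probability_setT.
have p1 : \sum_j p j = 1.
  have := Rintegral_codes mk PtT (fun=> ler01 : 0 <= (1:R)).
  rewrite Rintegral_cst_prob// => ->.
  by apply: eq_bigr => j _; rewrite mulr1.
pose m := \sum_j p j * v j.
pose Z j := sg * (m - v j) - 2 * lam * (v j ^+ 2 - m ^+ 2).
pose C := [set phi : {ffun 'I_n -> 'I_K} | n%:R * kap < \sum_i Z (phi i)]%SET.
have [E [mE PE EC]] := samples_codes xiP tT C mk.
exists E; split => //.
  apply: le_trans PE _; rewrite lee_fin.
  apply: (@finite_chernoff _ _ p (fun j => lam / 2 * Z j)) => //.
    exact: (@compensated_moment_le1 _ _ _ _ B).
  move=> phi; rewrite inE => /ltW h; rewrite -mulr_sumr.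
  have -> : n%:R * lam * kap / 2 = lam / 2 * (n%:R * kap) by ring.
  by rewrite ler_pM2l// divr_gt0.
move=> w nEw y' my' y'B y'y.
have : [ffun i : 'I_n => k (xi t i w)] \notin C.
  by apply/negP => /EC.
rewrite inE -leNgt.
have nR0 : 0 < n%:R :> R by rewrite ltr0n.
set q := \int[Phat w]_x v (k x); set q2 := \int[Phat w]_x (v (k x) ^+ 2).
have mvk := measurable_codes mk v.
have mvk2 := measurable_codes mk (fun j => v j ^+ 2).
have qE : q = n%:R^-1 * \sum_(i < n) v (k (xi t i w)).
  by rewrite /q /Phat Rintegral_empirical// => x; case/andP: (vB (k x)).
have q2E : q2 = n%:R^-1 * \sum_(i < n) v (k (xi t i w)) ^+ 2.
  by rewrite /q2 /Phat (@Rintegral_empirical _ _ _ _ _ _ mvk2)// => x; exact: sqr_ge0.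
have -> : \sum_i Z ([ffun i : 'I_n => k (xi t i w)] i) =
    n%:R * (sg * (m - q) - 2 * lam * (q2 - m ^+ 2)).
  rewrite qE q2E -(sum_deviation _ _ _ _ n0).
  by apply: eq_bigr => i _; rewrite ffunE.
rewrite ler_pM2l// => good.
have PhatT : Phat w setT = 1%E by exact: empirical_setT.
have mE' : \int[P t]_x v (k x) = m.
  by rewrite (Rintegral_codes mk)// => j; case/andP: (vB j).
have yv x : `|y' x - v (k x)| <= 2 * eta.
  by have := y'y x; have := vk x; rewrite !ler_norml; lra.
have yv2 x : `|y' x ^+ 2 - v (k x) ^+ 2| <= 4 * B * eta.
  have -> : y' x ^+ 2 - v (k x) ^+ 2 = (y' x - v (k x)) * (y' x + v (k x)) by ring.
  rewrite normrM; have -> : 4 * B * eta = (2 * eta) * (2 * B) by ring.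
  apply: ler_pM => //; have := y'B x; have := vB (k x); rewrite ler_norml; lra.
have sqB (z : R) : 0 <= z <= B -> 0 <= z ^+ 2 <= B ^+ 2.
  by move=> /andP[? ?]; rewrite sqr_ge0/= lerXn2r ?nnegrE.
have h1 : `|\int[P t]_x y' x - m| <= 2 * eta.
  by rewrite -mE'; apply: (@Rintegral_close _ _ _ _ _ _ _ _ 0 B).
have h2 : `|\int[Phat w]_x y' x - q| <= 2 * eta.
  by apply: (@Rintegral_close _ _ _ _ _ _ _ _ 0 B).
have h3 : `|\int[Phat w]_x (y' x ^+ 2) - q2| <= 4 * B * eta.
  apply: (@Rintegral_close _ _ _ _ _ _ _ _ 0 (B ^+ 2)) => //.
  - exact: measurable_funX.
  - by move=> x; exact: sqB.
  - by move=> x; exact: sqB.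
have Py : 0 <= \int[P t]_x y' x <= B by apply: Rintegral_itv.
have mB : 0 <= m <= B by rewrite -mE'; apply: Rintegral_itv.
move: h1 h2 h3 Py good sg1; set a := \int[P t]_x y' x.
set b := \int[_]_x y' x; set b2 := \int[_]_x _ => h1 h2 h3 Py good sg1.
have h4 : `|a ^+ 2 - m ^+ 2| <= 4 * B * eta.
  have -> : a ^+ 2 - m ^+ 2 = (a - m) * (a + m) by ring.
  rewrite normrM; have -> : 4 * B * eta = (2 * eta) * (2 * B) by ring.
  apply: ler_pM => //; rewrite ler_norml; lra.
have h5 : sg * ((a - m) - (b - q)) <= 4 * eta.
  apply: le_trans (ler_norm _) _; rewrite normrM -[leRHS]mul1r.
  by apply: ler_pM => //; move: h1 h2; rewrite !ler_norml; lra.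
(* The squares move by at most [8 B eta] in total, and [2 lam * 8 B eta <= eta] because
   [lam * B <= 1/16]. *)
have h6 : 2 * lam * ((b2 - q2) - (a ^+ 2 - m ^+ 2)) >= - eta.
  have : - (8 * B * eta) <= (b2 - q2) - (a ^+ 2 - m ^+ 2).
    by move: h3 h4; rewrite !ler_norml; lra.
  move=> h7.
  have : 2 * lam * - (8 * B * eta) <= 2 * lam * ((b2 - q2) - (a ^+ 2 - m ^+ 2)).
    by rewrite ler_pM2l// mulr_gt0.
  have : (lam * B) * eta <= 16^-1 * eta by rewrite ler_pM2r.
  lra.
lra.
Qed.

End deviation.

(** * Dynamic programming *)

Section inf_image.
Context (R : realType) (U : Type).
Implicit Types (A : set U) (phi : U -> R).

Lemma inf_image_lb A phi m : A !=set0 -> (forall a, A a -> m <= phi a) ->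
  m <= inf [set phi a | a in A].
Proof.
move=> [a Aa] h; apply: lb_le_inf; first by exists (phi a), a.
by move=> _ [b Ab <-]; exact: h.
Qed.

Lemma inf_image_le A phi m a : (forall a, A a -> m <= phi a) -> A a ->
  inf [set phi a | a in A] <= phi a.
Proof.
move=> h Aa; apply: ge_inf; last by exists a.
by exists m => _ [b Ab <-]; exact: h.
Qed.

Lemma inf_image_adherent A phi m e : A !=set0 ->
  (forall a, A a -> m <= phi a) -> 0 < e ->
  exists2 a, A a & phi a <= inf [set phi a | a in A] + e.
Proof.
move=> [a Aa] h e0.
have [|_ [b Ab <-] /ltW be] := @inf_adherent _ [set phi a | a in A] e e0.
  split; first by exists (phi a), a.
  by exists m => _ [b Ab <-]; exact: h.
by exists b.
Qed.

Lemma inf_image_close A phi psi m e : A !=set0 ->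
  (forall a, A a -> m <= phi a) -> (forall a, A a -> m <= psi a) ->
  (forall a, A a -> `|phi a - psi a| <= e) ->
  `|inf [set phi a | a in A] - inf [set psi a | a in A]| <= e.
Proof.
move=> A0 hphi hpsi he.
have aux (f g : U -> R) : (forall a, A a -> m <= f a) ->
    (forall a, A a -> `|f a - g a| <= e) ->
    inf [set f a | a in A] - e <= inf [set g a | a in A].
  move=> hf hfg; apply: inf_image_lb => // a Aa.
  have := inf_image_le hf Aa; have := hfg a Aa; rewrite ler_norml; lra.
have := aux phi psi hphi he.
have : inf [set psi a | a in A] - e <= inf [set phi a | a in A].
  by apply: aux => // a Aa; rewrite distrC; exact: he.
rewrite ler_norml; lra.
Qed.

End inf_image.

Section dp_step.
Context (R : realType) (dS dA : nat) (M : soc R dS dA) (T : nat) (rad L : R).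
Hypotheses (spec : soc_spec M T) (reg : soc_regular M T rad L).

(** Continuity is given only within a subspace; the slice through a fixed admissible pair never
    leaves it. *)
Lemma trans_noise_continuous t s a : (t < T)%N -> states M t s ->
  controls M t a -> continuous (fun x : noise M t => trans s a x).
Proof.
move=> tT Ss Aa x.
have /subspace_continuousP/(_ (s, a, x)) h := trans_continuous spec tT.
apply: (@cvg_comp _ _ _ (fun y : noise M t => (s, a, y))
   (fun p => trans p.1.1 p.1.2 p.2) _ _ _ _ (h _)); last by split.
move=> D /= hD.
have : \forall y \near x, [set p : 'rV[R]_dS * 'rV[R]_dA * noise M t |
   states M t p.1.1 /\ controls M t p.1.2] (s, a, y) -> D (s, a, y).
  have c : continuous (fun y : noise M t => (s, a, y)).
    by move=> y; exact: (cvg_pair (cvg_cst (s, a)) cvg_id).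
  exact: c hD.
by apply: filterS => y; apply; split.
Qed.

Definition dp_step (Q : forall t, {measure set (borel (noise M t)) -> \bar R})
    (t : nat) (W : 'rV[R]_dS -> R -> R) (s : 'rV[R]_dS) (z : R) : R :=
  inf [set \int[Q t]_x W (trans s a x) (z + cost M t s a) | a in controls M t].

(** The two moduli are kept apart because a backward step leaves the one in the accumulated cost
    equal to [LC], while the one in the state grows geometrically. All real [z] are allowed, since
    the terminal function will be clipped. *)
Definition dp_regular (t : nat) (lo B K LC : R) (W : 'rV[R]_dS -> R -> R) :=
  (forall s z, states M t s -> lo <= W s z <= lo + B) /\
  (forall s s' z z', states M t s -> states M t s' ->
    `|W s z - W s' z'| <= K * enorm (s - s') + LC * `|z - z'|).

(** A Lipschitz function of a continuous transition is continuous in the noise. Convergence of the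
    transition is read coordinatewise, whence the factor [sqrt dS] in the tolerance. *)
Lemma measurable_next t lo B K LC W s a z : (t < T)%N -> 0 <= K ->
  dp_regular t.+1 lo B K LC W -> states M t s -> controls M t a ->
  measurable_fun setT (fun x : borel (noise M t) => W (trans s a x) z).
Proof.
move=> tT K0 [Wb WL] Ss Aa; apply: continuous_measurable_borel => x.
apply/cvgrPdist_le => e e0.
pose del := e / (K * Num.sqrt dS%:R + 1).
have den : 0 < K * Num.sqrt dS%:R + 1.
  by rewrite ltr_wpDl// mulr_ge0// sqrtr_ge0.
have del0 : 0 < del by rewrite divr_gt0.
have tS (y : noise M t) : states M t.+1 (trans s a y) by exact: (trans_states spec).
have : \forall y \near x, forall j,
    `|trans s a x ord0 j - trans s a y ord0 j| <= del.
  apply: filter_forall => j.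
  have c := trans_noise_continuous tT Ss Aa.
  have : (fun y : noise M t => trans s a y ord0 j) @ x --> trans s a x ord0 j.
    apply: (@cvg_comp _ _ _ (fun y : noise M t => trans s a y)
      (fun N : 'rV[R]_dS => N ord0 j)); first exact: c.
    exact: coord_continuous.
  by move/cvgrPdist_le => /(_ _ del0).
apply: filterS => y hy.
apply: le_trans (WL _ _ _ _ (tS x) (tS y)) _.
rewrite subrr normr0 mulr0 addr0.
have h : enorm (trans s a x - trans s a y) <= Num.sqrt dS%:R * del.
  by apply: enorm_le_coord => j; have := hy j; rewrite !mxE.
apply: (le_trans (ler_wpM2l K0 h)); rewrite mulrA /del mulrA ler_pdivrMr//.
by rewrite mulrDr mulr1 mulrC lerDl ltW.
Qed.

Section law.
Variable Q : forall t, {measure set (borel (noise M t)) -> \bar R}.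
Hypothesis QT : forall t, (t < T)%N -> Q t setT = 1%E.
Variables (lo B LC : R).
Hypotheses (LC0 : 0 <= LC) (L0 : 0 <= L).

Lemma next_bounded t K W s a z : (t < T)%N ->
  dp_regular t.+1 lo B K LC W -> states M t s -> controls M t a ->
  forall x : noise M t, lo <= W (trans s a x) z <= lo + B.
Proof. by move=> tT [Wb _] Ss Aa x; apply: Wb; exact: (trans_states spec). Qed.

Lemma next_close t K W s a s' a' z z' : (t < T)%N -> 0 <= K ->
  dp_regular t.+1 lo B K LC W -> states M t s -> controls M t a ->
  states M t s' -> controls M t a' ->
  forall x : noise M t,
  `|W (trans s a x) (z + cost M t s a) - W (trans s' a' x) (z' + cost M t s' a')|
   <= (K * L + LC * L) * (enorm (s - s') + enorm (a - a')) + LC * `|z - z'|.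
Proof.
move=> tT K0 [_ WL] Ss Aa Ss' Aa' x.
apply: le_trans (WL _ _ _ _ _ _) _; [exact: (trans_states spec)..|].
have d := dist_pair_le s s' a a'.
have hF := trans_lipschitz reg x tT Ss Ss' Aa Aa'.
have hc := cost_lipschitz reg (ltnW tT) Ss Ss' Aa Aa'.
have {d} d : L * dist_pair s s' a a' <= L * (enorm (s - s') + enorm (a - a')).
  by rewrite ler_wpM2l.
have h1 := ler_wpM2l K0 (le_trans hF d).
have h2 : `|z + cost M t s a - (z' + cost M t s' a')| <=
    `|z - z'| + `|cost M t s a - cost M t s' a'|.
  by apply: le_trans (ler_normD _ _); rewrite le_eqVlt; apply/orP; left;
      apply/eqP; congr (`|_|); ring.
have h3 := ler_wpM2l LC0 (le_trans h2 (lerD (lexx _) (le_trans hc d))).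
by apply: le_trans (lerD h1 h3) _; rewrite le_eqVlt; apply/orP; left; apply/eqP; ring.
Qed.

Lemma mean_next_itv t K W s a z : (t < T)%N ->
  dp_regular t.+1 lo B K LC W -> states M t s -> controls M t a ->
  lo <= \int[Q t]_x W (trans s a x) z <= lo + B.
Proof.
move=> tT hW Ss Aa; apply: Rintegral_itv => //; first exact: QT.
by move=> x _; exact: (next_bounded _ tT hW).
Qed.

Lemma mean_next_close t K W s a s' a' z z' : (t < T)%N -> 0 <= K ->
  dp_regular t.+1 lo B K LC W -> states M t s -> controls M t a ->
  states M t s' -> controls M t a' ->
  `|\int[Q t]_x W (trans s a x) (z + cost M t s a) -
    \int[Q t]_x W (trans s' a' x) (z' + cost M t s' a')|
   <= (K * L + LC * L) * (enorm (s - s') + enorm (a - a')) + LC * `|z - z'|.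
Proof.
move=> tT K0 hW Ss Aa Ss' Aa'.
apply: (@Rintegral_close _ _ _ _ _ _ _ _ lo (lo + B)).
- exact: QT.
- exact: (measurable_next _ tT K0 hW).
- exact: (measurable_next _ tT K0 hW).
- exact: (next_bounded _ tT hW).
- exact: (next_bounded _ tT hW).
- exact: (next_close _ _ tT K0 hW).
Qed.

Lemma dp_step_regular t K W : (t < T)%N -> 0 <= K ->
  dp_regular t.+1 lo B K LC W -> dp_regular t lo B (K * L + LC * L) LC (dp_step Q t W).
Proof.
move=> tT K0 hW.
have A0 := controls_neq0 spec (ltnW tT).
split => [s z Ss|s s' z z' Ss Ss'].
- apply/andP; split.
    apply: inf_image_lb => // a Aa.
    by case/andP: (mean_next_itv (z + cost M t s a) tT hW Ss Aa).
  have [a Aa] := A0; have /andP[_ h] := mean_next_itv (z + cost M t s a) tT hW Ss Aa.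
  apply: le_trans h; apply: (inf_image_le (m := lo)) => // b Ab.
  by case/andP: (mean_next_itv (z + cost M t s b) tT hW Ss Ab).
- apply: (inf_image_close (m := lo)) => // a Aa.
  + by case/andP: (mean_next_itv (z + cost M t s a) tT hW Ss Aa).
  + by case/andP: (mean_next_itv (z' + cost M t s' a) tT hW Ss' Aa).
  + have := mean_next_close z z' tT K0 hW Ss Aa Ss' Aa.
    by rewrite subrr enorm0 addr0.
Qed.

Definition dp_last (g : R -> R) (s : 'rV[R]_dS) (z : R) : R :=
  inf [set g (z + cost M T s a) | a in controls M T].

(** Recursion on the number [k] of remaining steps makes backward induction structural; the current
    time is [T - k]. *)
Fixpoint value_rec (g : R -> R) (k : nat) : 'rV[R]_dS -> R -> R :=
  if k is k'.+1 then dp_step Q (T - k) (value_rec g k') else dp_last g.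

Definition value (g : R -> R) (t : nat) := value_rec g (T - t).

Lemma value_last g : value g T = dp_last g.
Proof. by rewrite /value subnn. Qed.

Lemma value_step g t : (t < T)%N -> value g t = dp_step Q t (value g t.+1).
Proof.
move=> tT; rewrite /value -(subnSK tT) /=; congr (dp_step Q _ _).
by rewrite (subnSK tT) subKn// ltnW.
Qed.

Variable g : R -> R.
Hypotheses (gb : forall z, lo <= g z <= lo + B)
  (gL : forall z z', `|g z - g z'| <= LC * `|z - z'|).

Lemma dp_last_regular : dp_regular T lo B (LC * L) LC (dp_last g).
Proof.
have A0 := controls_neq0 spec (leqnn T).
split => [s z Ss|s s' z z' Ss Ss'].
- apply/andP; split.
    by apply: inf_image_lb => // a Aa; case/andP: (gb (z + cost M T s a)).
  have [a Aa] := A0; have /andP[_ h] := gb (z + cost M T s a).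
  apply: le_trans h; apply: (inf_image_le (m := lo)) => // b Ab.
  by case/andP: (gb (z + cost M T s b)).
- apply: (inf_image_close (m := lo)) => // a Aa.
  + by case/andP: (gb (z + cost M T s a)).
  + by case/andP: (gb (z' + cost M T s' a)).
  + apply: le_trans (gL _ _) _.
    have hc := cost_lipschitz reg (leqnn T) Ss Ss' Aa Aa.
    have := dist_pair_le s s' a a; rewrite subrr enorm0 addr0 => d.
    have {d hc} hc := le_trans hc (ler_wpM2l L0 d).
    have h2 : `|z + cost M T s a - (z' + cost M T s' a)| <=
        `|z - z'| + `|cost M T s a - cost M T s' a|.
      by apply: le_trans (ler_normD _ _); rewrite le_eqVlt; apply/orP; left;
      apply/eqP; congr (`|_|); ring.
    have := ler_wpM2l LC0 (le_trans h2 (lerD (lexx _) hc)); lra.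
Qed.

Variable Lam : R.
Hypotheses (Lam2 : 2 <= Lam) (LLam : L <= Lam).

(** One step turns [K] into [(K + LC) * L]. The correction [- Lam] closes the induction: [Lam * (2
    Lam^(k+1) - Lam + 1) <= 2 Lam^(k+2) - Lam] is exactly [Lam >= 2]. *)
Lemma value_rec_regular k : (k <= T)%N ->
  dp_regular (T - k) lo B (LC * (2 * Lam ^+ k.+1 - Lam)) LC (value_rec g k).
Proof.
have weak t K K' W : K <= K' -> dp_regular t lo B K LC W -> dp_regular t lo B K' LC W.
  move=> KK' [h1 h2]; split => // s s' z z' Ss Ss'.
  by apply: le_trans (h2 _ _ _ _ Ss Ss') _; rewrite lerD2r ler_wpM2r// enorm_ge0.
have [hLam hLLam hLC] : [/\ 2 <= Lam, L <= Lam & 0 <= LC] by [].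
elim: k => [_|k IH kT].
  rewrite subn0; apply: weak dp_last_regular.
  by rewrite expr1 ler_wpM2l//; lra.
have kT' : (T - k.+1 < T)%N by rewrite ltn_subrL (leq_trans _ kT).
have Lk : Lam <= Lam ^+ k.+1.
  by rewrite exprS ler_peMr ?exprn_ege1//; lra.
have K0 : 0 <= LC * (2 * Lam ^+ k.+1 - Lam) by rewrite mulr_ge0//; lra.
have := IH (ltnW kT); rewrite -(subnSK kT) => /(dp_step_regular kT' K0).
apply: weak; rewrite -mulrA -mulrDr ler_wpM2l// [Lam ^+ k.+2]exprS.
have Lk0 : 0 <= 2 * Lam ^+ k.+1 - Lam + 1 by lra.
have := ler_wpM2l Lk0 LLam; nra.
Qed.

Lemma value_regular t : (t <= T)%N ->
  dp_regular t lo B (2 * LC * Lam ^+ (T - t).+1) LC (value g t).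
Proof.
move=> tT; have hLam := Lam2.
have := value_rec_regular (leq_subr t T); rewrite subKn//.
rewrite /value => -[h1 h2]; split => // s s' z z' Ss Ss'.
apply: le_trans (h2 _ _ _ _ Ss Ss') _.
rewrite lerD2r ler_wpM2r ?enorm_ge0// [2 * LC]mulrC -mulrA ler_wpM2l//; lra.
Qed.

End law.
End dp_step.

Section admissible.
Context (R : realType) (dS dA : nat) (M : soc R dS dA) (T : nat) (rad L : R).
Hypotheses (spec : soc_spec M T) (reg : soc_regular M T rad L).

Lemma measurable_controls t : (t <= T)%N ->
  measurable (controls M t : set (borel 'rV[R]_dA)).
Proof.
move=> tT; apply: closed_measurable_borel; apply: compact_closed.
  exact: norm_hausdorff.
exact: (controls_compact reg).
Qed.

Fixpoint admissible (t : nat) : ctrls R dA t -> Prop :=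
  match t with
  | 0 => fun _ => True
  | t'.+1 => fun a => admissible a.1 /\ controls M t' a.2
  end.

Lemma state_in s t (h : hist (noise M) t) (a : ctrls R dA t) : (t <= T)%N ->
  states M 0 s -> admissible a -> states M t (state s h a).
Proof.
elim: t h a => [//|t IH] h a tT Ss [a1 a2] /=.
by apply: (trans_states spec) => //; apply: IH => //; exact: ltnW.
Qed.

Lemma sum_cost_itv s t (h : hist (noise M) t) (a : ctrls R dA t) : (t <= T)%N ->
  states M 0 s -> admissible a -> 0 <= sum_cost s h a <= t%:R.
Proof.
elim: t h a => [|t IH] h a tT Ss /=; first by rewrite lexx.
move=> [a1 a2]; have := IH h.1 a.1 (ltnW tT) Ss a1.
have := cost_range spec (ltnW tT) (state_in h.1 (ltnW tT) Ss a1) a2.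
rewrite -natr1; lra.
Qed.

End admissible.

(** * The value function bounds the cost of every policy from below *)

Section dp_lower.
Context (R : realType) (dS dA : nat) (M : soc R dS dA) (T : nat) (rad L : R).
Hypotheses (spec : soc_spec M T) (reg : soc_regular M T rad L).
Variable Q : forall t, {measure set (borel (noise M t)) -> \bar R}.
Hypothesis QT : forall t, (t < T)%N -> Q t setT = 1%E.
Variables (lo B LC : R) (f g : R -> R).
Hypotheses (LC0 : 0 <= LC) (L0 : 0 <= L)
  (gb : forall z, lo <= g z <= lo + B)
  (gL : forall z z', `|g z - g z'| <= LC * `|z - z'|)
  (fg : forall z, 0 <= z <= T.+1%:R -> f z = g z).

Let V := value T Q g.

Let Vreg t : (t <= T)%N -> exists2 K, 0 <= K & dp_regular M t lo B K LC (V t).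
Proof.
move=> tT; have Lam2 : 2 <= Num.max L 2 by rewrite le_max lexx orbT.
have LLam : L <= Num.max L 2 by rewrite le_max lexx.
have h := value_regular spec reg QT LC0 L0 gb gL Lam2 LLam tT.
eexists; last exact: h.
rewrite mulr_ge0 ?mulr_ge0// exprn_ge0//; apply: le_trans Lam2; lra.
Qed.

(** The last control is followed by no noise; the case distinction lets later arguments treat all
    [t <= T] alike. *)
Definition action_value (t : nat) (s : 'rV[R]_dS) (z : R) (a : 'rV[R]_dA) : R :=
  if (t < T)%N then \int[Q t]_x V t.+1 (trans s a x) (z + cost M t s a)
  else g (z + cost M t s a).

Lemma action_value_ge t s z a : (t <= T)%N -> states M t s -> controls M t a ->
  lo <= action_value t s z a.
Proof.
move=> tT Ss Aa; rewrite /action_value; case: ifPn => tT'.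
  have [K K0 hW] := Vreg tT'.
  by case/andP: (mean_next_itv spec QT (z + cost M t s a) tT' hW Ss Aa).
by case/andP: (gb (z + cost M t s a)).
Qed.

Lemma valueE t s z : (t <= T)%N ->
  V t s z = inf [set action_value t s z a | a in controls M t].
Proof.
rewrite leq_eqVlt => /orP[/eqP ->|tT].
  rewrite /V value_last /dp_last; congr inf; apply: eq_imagel => a Aa.
  by rewrite /action_value ltnn.
rewrite /V value_step// /dp_step; congr inf; apply: eq_imagel => a Aa.
by rewrite /action_value tT.
Qed.

Lemma value_le_action t s z a : (t <= T)%N -> states M t s -> controls M t a ->
  V t s z <= action_value t s z a.
Proof.
move=> tT Ss Aa; rewrite valueE//; apply: (inf_image_le (m := lo)) => // b Ab.
exact: action_value_ge.
Qed.

(** Serves to compare a trajectory with its rounded proxy. The constant may be crude (a sum of the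
    constants of all times) because the rounding mesh is chosen after it. *)
Lemma action_value_lip : exists2 Kq, 0 <= Kq & forall t s s' z z' a,
  (t <= T)%N -> states M t s -> states M t s' -> controls M t a ->
  `|action_value t s z a - action_value t s' z' a| <=
  Kq * (enorm (s - s') + `|z - z'|).
Proof.
have [K hK] : exists K : nat -> R, forall t, (t <= T)%N -> 0 <= K t /\
    dp_regular M t lo B (K t) LC (V t).
  have /boolp.choice[K hK] (t : nat) : exists K, (t <= T)%N -> 0 <= K /\
      dp_regular M t lo B K LC (V t).
    have [tT|tT] := boolP (t <= T)%N; last by exists 0.
    by have [K K0 hW] := Vreg tT; exists K.
  by exists K.
pose S := \sum_(t < T.+1) K t.
have K_S t : (t <= T)%N -> K t <= S.
  move=> tT; rewrite /S (bigD1 (Ordinal (tT : (t < T.+1)%N)))//= lerDl sumr_ge0//.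
  by move=> i _; have [] := hK i (ltn_ord i).
have S0 : 0 <= S.
  by apply: sumr_ge0 => i _; have [] := hK i (ltn_ord i).
have [hLC hL] : 0 <= LC /\ 0 <= L by [].
exists (S * L + LC * L + LC).
  by rewrite !addr_ge0// mulr_ge0.
move=> t s s' z z' a tT Ss Ss' Aa.
have e0 := enorm_ge0 (s - s'); have n0 := normr_ge0 (z - z').
have SL := mulr_ge0 S0 hL; have LL := mulr_ge0 hLC hL.
have fin k : 0 <= k -> k <= S * L + LC * L ->
   k * enorm (s - s') + LC * `|z - z'| <=
   (S * L + LC * L + LC) * (enorm (s - s') + `|z - z'|).
  move=> k0 kS; have := ler_wpM2r e0 kS.
  have := mulr_ge0 SL n0; have := mulr_ge0 LL n0; have := mulr_ge0 hLC e0; lra.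
rewrite /action_value; case: ifPn => tT'.
  have [K0 hW] := hK _ tT'.
  have := mean_next_close spec reg QT LC0 L0 z z' tT' K0 hW Ss Aa Ss' Aa.
  rewrite subrr enorm0 addr0 => /le_trans; apply; apply: fin.
    by rewrite addr_ge0// mulr_ge0.
  by rewrite lerD2r ler_wpM2r// K_S.
have e : t = T by apply/eqP; rewrite eqn_leq tT leqNgt.
apply: le_trans (gL _ _) _.
have hc := cost_lipschitz reg tT Ss Ss' Aa Aa.
have := dist_pair_le s s' a a; rewrite subrr enorm0 addr0 => dd.
have {dd hc} hc := le_trans hc (ler_wpM2l hL dd).
apply: le_trans _ (fin (LC * L) _ _) => //; last by rewrite lerDr.
rewrite -mulrA -mulrDr ler_wpM2l//.
have -> : z + cost M t s a - (z' + cost M t s' a) =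
  (cost M t s a - cost M t s' a) + (z - z') by ring.
by apply: le_trans (ler_normD _ _) _; rewrite lerD2r.
Qed.

Lemma value_itv t s z : (t <= T)%N -> states M t s -> lo <= V t s z <= lo + B.
Proof. by move=> tT Ss; have [K K0 [h _]] := Vreg tT; exact: h. Qed.

Variable pol : policy M.
Hypothesis polP : policies M T pol.

(** Peeling off the last noise and control, the inner integral of [G] dominates the action value at
    [b], hence the value at time [t], for every [b]; averaging over [b] preserves this. The upper
    bound [lo + B] keeps all integrals finite. *)
Lemma expect_ge s t (G : hist (noise M) t -> ctrls R dA t -> R) : (t <= T)%N ->
  states M 0 s ->
  (forall h a, admissible M a ->
     V t (state s h a) (sum_cost s h a) <= G h a <= lo + B) ->
  V 0 s 0 <= expect Q pol G.
Proof.
move=> + Ss; elim: t G => [|t IH] G tT hG /=.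
  by have /andP[] := hG tt tt I.
apply: IH; first exact: ltnW.
move=> h a aa; have Sh := state_in spec h (ltnW tT) Ss aa.
apply: Rintegral_itv.
- exact: (measurable_controls reg (ltnW tT)).
- by apply: polP; exact: ltnW.
move=> b Ab.
have := value_le_action (sum_cost s h a) (ltnW tT) Sh Ab.
rewrite /action_value tT => h1.
have inner (x : borel (noise M t)) :
    V t.+1 (trans (state s h a) b x) (sum_cost s h a + cost M t (state s h a) b) <=
    G (h, x) (a, b) <= lo + B.
  exact: (hG (h, x) (a, b)).
have [K K0 hW] := Vreg tT.
have nb := next_bounded spec (sum_cost s h a + cost M t (state s h a) b) tT hW Sh Ab.
have Gb (x : borel (noise M t)) : lo <= G (h, x) (a, b) <= lo + B.
  by have := inner x; have := nb x; lra.
apply/andP; split; last first.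
  by have /andP[] := Rintegral_itv measurableT (QT tT) (fun x _ => Gb x).
apply: le_trans h1 _.
apply: (@le_Rintegral_bounded _ _ _ _ _ _ _ _ _ lo (lo + B)) => //.
- exact: QT.
- by move=> x _; have /andP[] := inner x.
Qed.

Lemma value_le_expected_cost s : states M 0 s ->
  V 0 s 0 <= expected_cost T Q pol f s.
Proof.
move=> Ss; apply: expect_ge => // h a aa.
have Sh := state_in spec h (leqnn T) Ss aa.
apply: Rintegral_itv.
- exact: (measurable_controls reg (leqnn T)).
- by apply: polP.
move=> b Ab.
have cz := cost_range spec (leqnn T) Sh Ab.
have sz := sum_cost_itv spec h (leqnn T) Ss aa.
rewrite fg; last by rewrite -natr1; lra.
have /andP[_ ->] := gb (sum_cost s h a + cost M T (state s h a) b).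
rewrite andbT.
by have := value_le_action (sum_cost s h a) (leqnn T) Sh Ab; rewrite /action_value ltnn.
Qed.

End dp_lower.

(** A preimage is a countable union of code cells, so [phi] can be any function, in particular one
    obtained by choice. This replaces a measurable selection of near-optimal controls. *)
Lemma measurable_countable_codes d d' (X : measurableType d)
    (Y : measurableType d') (K : countType) (c : X -> K) (phi : K -> Y) :
  (forall k, measurable (c @^-1` [set k])) -> measurable_fun setT (phi \o c).
Proof.
move=> mc _ U mU; rewrite setTI.
have -> : (phi \o c) @^-1` U =
    \bigcup_k (if phi k \in U then c @^-1` [set k] else set0).
  apply/seteqP; split => x /=.
    by move=> Ux; exists (c x) => //; rewrite mem_set.
  by move=> [k _]; case: ifPn => // /set_mem Uk /= ->.
apply: countable_bigcupT_measurable => [|k]; first exact: countableP.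
by case: ifPn.
Qed.

(** * Near-optimal policies from rounded trajectories *)

Section rounding.
Context (R : realType) (d : nat) (h : R).
Hypothesis h0 : 0 < h.

Definition grid_code (y : 'rV[R]_d) : 'rV[int]_d :=
  \row_j Num.floor (y ord0 j / h).

Lemma grid_code_close y y' : grid_code y = grid_code y' ->
  enorm (y - y') <= Num.sqrt d%:R * h.
Proof.
move=> /rowP e; apply: enorm_le_coord => j.
have hh := h0; move: (e j); rewrite !mxE => fe.
have := floor_itv (y ord0 j / h); have := floor_itv (y' ord0 j / h).
rewrite fe intrD ler_pdivlMr// ltr_pdivrMr// ler_pdivlMr// ltr_pdivrMr//.
rewrite ler_norml mulrDl mul1r; lra.
Qed.

Lemma grid_code_measurable (X : ptopologicalType) (F : X -> 'rV[R]_d) k :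
  continuous F -> measurable ((grid_code \o F) @^-1` [set k] : set (borel X)).
Proof.
move=> cF.
have -> : (grid_code \o F) @^-1` [set k] =
  \bigcap_(j in [set: 'I_d])
    (fun x : borel X => F x ord0 j / h) @^-1`
       `[(k ord0 j)%:~R, (k ord0 j + 1)%:~R[%classic.
  apply/seteqP; split => x /=.
    by move=> <- j _ /=; rewrite in_itv/= mxE floor_itv.
  move=> hx; apply/rowP => j; rewrite mxE; apply/eqP; rewrite floor_eq.
  by have := hx j I; rewrite /= in_itv.
apply: fin_bigcap_measurable => [|j _]; first exact: finite_finset.
have mf : measurable_fun setT (fun x : borel X => F x ord0 j / h).
  apply: continuous_measurable_borel => x.
  apply: cvgMr_tmp.
  apply: (@cvg_comp _ _ _ F (fun N : 'rV[R]_d => N ord0 j)); first exact: cF.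
  exact: coord_continuous.
by rewrite -[X in measurable X]setTI; apply: mf.
Qed.

End rounding.

Section dp_upper.
Context (R : realType) (dS dA : nat) (M : soc R dS dA) (T : nat) (rad L : R).
Hypotheses (spec : soc_spec M T) (reg : soc_regular M T rad L).
Variable Q : forall t, {measure set (borel (noise M t)) -> \bar R}.
Hypothesis QT : forall t, (t < T)%N -> Q t setT = 1%E.
Variables (lo B LC : R) (f g : R -> R).
Hypotheses (LC0 : 0 <= LC) (L0 : 0 <= L)
  (gb : forall z, lo <= g z <= lo + B)
  (gL : forall z z', `|g z - g z'| <= LC * `|z - z'|)
  (fg : forall z, 0 <= z <= T.+1%:R -> f z = g z).

Let V := value T Q g.
Let AV := action_value T Q g.

Section construction.
Variables (s0 : 'rV[R]_dS) (h : R).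
Hypotheses (Ss0 : states M 0 s0) (h0 : 0 < h).
Variable sel : nat -> 'rV[R]_dS -> R -> 'rV[R]_dA.
Hypothesis selA : forall t s z, (t <= T)%N -> controls M t (sel t s z).
Variable rep : nat -> 'rV[int]_dS -> 'rV[R]_dS.
Hypothesis repS : forall t k, (t <= T)%N -> states M t (rep t k).
Hypothesis repK : forall t y, (t <= T)%N -> states M t y ->
  grid_code h (rep t (grid_code h y)) = grid_code h y.

(* The policy follows a proxy trajectory whose states are rounded at every step.
   Its actions depend on the history through countably many codes, so they are
   measurable in the history. The head of the list is the latest code. *)
Fixpoint proxy (l : seq 'rV[int]_dS) : 'rV[R]_dS * R :=
  if l is k :: l' then
    let p := proxy l' in
    (rep (size l) k, p.2 + cost M (size l') p.1 (sel (size l') p.1 p.2))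
  else (s0, 0).

Definition proxy_act l := sel (size l) (proxy l).1 (proxy l).2.

Fixpoint codes (t : nat) : hist (noise M) t -> seq 'rV[int]_dS :=
  match t with
  | 0 => fun _ => [::]
  | t'.+1 => fun h' =>
      grid_code h (trans (proxy (codes h'.1)).1 (proxy_act (codes h'.1)) h'.2)
        :: codes h'.1
  end.

Lemma size_codes t (h' : hist (noise M) t) : size (codes h') = t.
Proof. by elim: t h' => //= t IH h'; rewrite IH. Qed.

Lemma proxy_states l : (size l <= T)%N -> states M (size l) (proxy l).1.
Proof. by case: l => [_|k l lT] //=; exact: repS. Qed.

Lemma proxy_act_controls l : (size l <= T)%N ->
  controls M (size l) (proxy_act l).
Proof. by move=> lT; exact: selA. Qed.

(** With the earlier codes fixed, the proxy state and control are constants, so the new code is a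
    grid cell of a continuous function of the latest noise alone. The preimage of [k :: l] is thus a
    rectangle. *)
Lemma codes_measurable t l : (t <= T)%N ->
  measurable (@codes t @^-1` [set l]).
Proof.
elim: t l => [|t IH] l tT.
  have [->|ne] := eqVneq l [::].
    by rewrite (_ : _ @^-1` _ = setT)//; apply/seteqP; split.
  rewrite (_ : _ @^-1` _ = set0)//; apply/seteqP; split => // x /= e.
  by rewrite e eqxx in ne.
case: l => [|k l].
  by rewrite (_ : _ @^-1` _ = set0)//; apply/seteqP; split.
have [lt|lt] := eqVneq (size l) t; last first.
  rewrite (_ : _ @^-1` _ = set0)//; apply/seteqP; split => // x /= [_ e].
  by rewrite -e size_codes eqxx in lt.
have -> : @codes t.+1 @^-1` [set k :: l] =
    (@codes t @^-1` [set l]) `*`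
    ((grid_code h \o (fun x : noise M t => trans (proxy l).1 (proxy_act l) x))
       @^-1` [set k]).
  apply/seteqP; split => -[h' x] /=.
    by move=> [e1 e2]; rewrite -e1 e2.
  by move=> [-> ->].
apply: measurableX; first by apply: IH; exact: ltnW.
apply: (@grid_code_measurable R dS h (noise M t)
  (fun x => trans (proxy l).1 (proxy_act l) x) k).
apply: (trans_noise_continuous spec tT).
- by rewrite -lt; apply: proxy_states; rewrite lt ltnW.
- by rewrite -lt; apply: proxy_act_controls; rewrite lt ltnW.
Qed.

(** A policy is a kernel at every time; beyond [T] a constant is enough. *)
Definition proxy_policy_fun t (h' : hist (noise M) t) : borel 'rV[R]_dA :=
  if (t <= T)%N then proxy_act (codes h') else point.

Lemma measurable_proxy_policy_fun t : measurable_fun setT (@proxy_policy_fun t).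
Proof.
rewrite /proxy_policy_fun; case: (t <= T)%N (@codes_measurable t) => // mc.
apply: (@measurable_countable_codes _ _ _ (borel 'rV[R]_dA)
  (seq 'rV[int]_dS) (@codes t) proxy_act) => l.
exact: mc.
Qed.

Definition proxy_policy : policy M :=
  fun t => kdirac (@measurable_proxy_policy_fun t).

Lemma proxy_policyP : policies M T proxy_policy.
Proof.
move=> t h' tT; rewrite /proxy_policy /= /kdirac diracE mem_set//=.
rewrite /proxy_policy_fun tT.
have := @proxy_act_controls (codes h'); rewrite size_codes; exact.
Qed.

Fixpoint proxy_ctrls (t : nat) : hist (noise M) t -> ctrls R dA t :=
  match t with
  | 0 => fun _ => tt
  | t'.+1 => fun h' => (proxy_ctrls h'.1, proxy_policy_fun h'.1)
  end.

Lemma proxy_ctrls_admissible t (h' : hist (noise M) t) : (t <= T)%N ->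
  admissible M (proxy_ctrls h').
Proof.
elim: t h' => //= t IH h' tT; split; first by apply: IH; exact: ltnW.
rewrite /proxy_policy_fun (ltnW tT).
have := @proxy_act_controls (codes h'.1); rewrite size_codes.
by apply; exact: ltnW.
Qed.

(** Trajectory error in units of the rounding error [sqrt dS * h]. A state error [D] becomes at most
    [L D + 1] after transition and rounding, a cost error at most [D + L D]; the recursion dominates
    both. *)
Fixpoint drift (t : nat) : R := if t is t'.+1 then (1 + L) * drift t' + 1 else 0.

Lemma drift_ge0 t : 0 <= drift t.
Proof.
have hL := L0; elim: t => //= t IH.
by rewrite addr_ge0// mulr_ge0// addr_ge0.
Qed.

Lemma drift_le t t' : (t <= t')%N -> drift t <= drift t'.
Proof.
have hL := L0; move=> /subnK <-; elim: (t' - t)%N => [|k IH]; first by rewrite add0n.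
rewrite addSn /=; apply: le_trans IH _.
have D0 := drift_ge0 (k + t); have := mulr_ge0 hL D0; lra.
Qed.

Lemma proxy_close t (h' : hist (noise M) t) : (t <= T)%N ->
  enorm (state s0 h' (proxy_ctrls h') - (proxy (codes h')).1)
    <= Num.sqrt dS%:R * h * drift t /\
  `|sum_cost s0 h' (proxy_ctrls h') - (proxy (codes h')).2|
    <= Num.sqrt dS%:R * h * drift t.
Proof.
set eta := Num.sqrt _ * h.
have eta0 : 0 <= eta by rewrite mulr_ge0 ?sqrtr_ge0// ltW.
have hL := L0.
elim: t h' => [|t IH] h' tT /=.
  by rewrite !subrr enorm0 normr0 mulr0.
have [IH1 IH2] := IH h'.1 (ltnW tT).
have D0 := drift_ge0 t.
have Aa : controls M t (proxy_act (codes h'.1)).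
  by have := @proxy_act_controls (codes h'.1); rewrite size_codes; apply; exact: ltnW.
have Sp : states M t (proxy (codes h'.1)).1.
  by have := @proxy_states (codes h'.1); rewrite size_codes; apply; exact: ltnW.
have Ss := state_in spec h'.1 (ltnW tT) Ss0 (proxy_ctrls_admissible h'.1 (ltnW tT)).
rewrite /proxy_policy_fun (ltnW tT) size_codes.
have -> : sel t (proxy (codes h'.1)).1 (proxy (codes h'.1)).2 =
    proxy_act (codes h'.1) by rewrite /proxy_act size_codes.
move: Aa Sp Ss IH1 IH2; set a := proxy_act _; set p := proxy (codes h'.1).
set S := state _ _ _; set z := sum_cost _ _ _ => Aa Sp Ss IH1 IH2.
have dd := dist_pair_le S p.1 a a; rewrite subrr enorm0 addr0 in dd.
have {}dd : L * dist_pair S p.1 a a <= L * (eta * drift t).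
  by apply: ler_wpM2l => //; exact: le_trans dd IH1.
have ed := mulr_ge0 eta0 D0.
split.
- apply: le_trans (enorm_triangle (trans p.1 a h'.2) _ _) _.
  have h1 : enorm (trans p.1 a h'.2 - rep t.+1 (grid_code h (trans p.1 a h'.2))) <= eta.
    apply: grid_code_close => //; rewrite repK//.
    exact: (trans_states spec).
  have := trans_lipschitz reg h'.2 tT Ss Sp Aa Aa; lra.
- have -> : z + cost M t S a - (p.2 + cost M t p.1 a) =
    (z - p.2) + (cost M t S a - cost M t p.1 a) by ring.
  apply: le_trans (ler_normD _ _) _.
  have := cost_lipschitz reg (ltnW tT) Ss Sp Aa Aa; lra.
Qed.

(** The Dirac policy collapses the last control integral to the proxy control, and the noise
    integral is then at most the action value plus [r], that is, at most [V + e + r]. Each of the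
    [t] peeled steps therefore costs [e]. *)
Lemma proxy_expect_le (hi e : R) t
    (G : hist (noise M) t -> ctrls R dA t -> R) r : (t <= T)%N -> lo + B <= hi ->
  (forall t (h' : hist (noise M) t), (t <= T)%N ->
    AV t (state s0 h' (proxy_ctrls h')) (sum_cost s0 h' (proxy_ctrls h'))
       (proxy_policy_fun h') <=
    V t (state s0 h' (proxy_ctrls h')) (sum_cost s0 h' (proxy_ctrls h')) + e) ->
  (forall h' a, admissible M a -> lo <= G h' a <= hi) ->
  (forall h', G h' (proxy_ctrls h') <=
     V t (state s0 h' (proxy_ctrls h')) (sum_cost s0 h' (proxy_ctrls h')) + r) ->
  expect Q proxy_policy G <= V 0 s0 0 + r + t%:R * e.
Proof.
move=> + hhi opt; elim: t G r => [|t IH] G r tT Gb Gr.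
  by rewrite mul0r addr0; exact: (Gr tt).
rewrite -natr1 mulrDl mul1r [t%:R * e + e]addrC addrA -[_ + r + e]addrA.
apply: IH; first exact: ltnW.
- move=> h' a aa; apply: Rintegral_itv.
  + exact: (measurable_controls reg (ltnW tT)).
  + by apply: proxy_policyP; exact: ltnW.
  move=> b Ab; apply: Rintegral_itv; [by []|exact: QT|].
  by move=> x _; apply: Gb.
move=> h'.
have aa := proxy_ctrls_admissible h' (ltnW tT).
have Sh := state_in spec h' (ltnW tT) Ss0 aa.
have Ab : controls M t (proxy_policy_fun h').
  by have [] := @proxy_ctrls_admissible t.+1 (h', point) tT.
have Gbx b (x : borel (noise M t)) : controls M t b ->
    lo <= G (h', x) (proxy_ctrls h', b) <= hi.
  by move=> ?; apply: Gb.
rewrite /proxy_policy /kdirac.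
rewrite (@Rintegral_dirac_set1 _ _ _ _ _ _ lo hi)//; last first.
- move=> b Abb; apply: Rintegral_itv; [by []|exact: QT|].
  by move=> x _; exact: Gbx.
- apply: closed_measurable_borel; apply: accessible_closed_set1.
  by apply: hausdorff_accessible; exact: norm_hausdorff.
- exact: (measurable_controls reg (ltnW tT)).
have Lam2 : 2 <= Num.max L 2 by rewrite le_max lexx orbT.
have LLam : L <= Num.max L 2 by rewrite le_max lexx.
have hW := value_regular spec reg QT LC0 L0 gb gL Lam2 LLam tT.
have Kp : 0 <= 2 * LC * Num.max L 2 ^+ (T - t.+1).+1.
  by rewrite !mulr_ge0// exprn_ge0//; apply: le_trans Lam2; lra.
set z := sum_cost s0 h' (proxy_ctrls h'); set S := state s0 h' (proxy_ctrls h').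
have nb := next_bounded spec (z + cost M t S (proxy_policy_fun h')) tT hW Sh Ab.
apply: (@le_trans _ _ (AV t S z (proxy_policy_fun h') + r)).
  rewrite /AV /action_value tT.
  have mm := measurable_next spec (z + cost M t S (proxy_policy_fun h')) tT Kp hW Sh Ab.
  rewrite -(RintegralDcst (QT tT) r mm nb).
  (* The sign of [r] is unknown, whence the minimum and maximum in the common bounds. *)
  apply: (@le_Rintegral_bounded _ _ _ _ _ _ _ _ _ (Num.min lo (lo + r))
    (Num.max hi (hi + r))) => //.
  + exact: QT.
  + move=> x _; have /andP[h1 h2] := Gbx (proxy_policy_fun h') x Ab.
    by rewrite ge_min h1 le_max h2.
  + move=> x _; have /andP[h1 h2] := nb x.
    by rewrite ge_min le_max !lerD2r h1 orbT (le_trans h2) ?orbT.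
have := opt t h' (ltnW tT); rewrite -/z -/S; lra.
Qed.

End construction.

(** The tolerance is split into [T + 1] shares [e2], one per control. Within a share, [e2 / 2] pays
    for a near-minimiser at the proxy point and [e2 / 4] twice for moving the action value and the
    value from the proxy to the real trajectory. *)
Lemma near_optimal_policy s e : states M 0 s -> 0 < e ->
  exists2 pol : policy M, policies M T pol &
    expected_cost T Q pol f s <= V 0 s 0 + e.
Proof.
move=> Ss e0.
have [Kq Kq0 hKq] := action_value_lip spec reg QT LC0 L0 gb gL.
pose e2 := e / T.+1%:R.
have T0 : 0 < T.+1%:R :> R by rewrite ltr0n.
have e20 : 0 < e2 by rewrite divr_gt0.
(* Chosen so that [D * h = e2 / 2] gives [Kq * 2 * (sqrt dS * h * drift T) <= e2 / 4]; the added
   ones keep [D] positive. *)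
pose D := (Num.sqrt dS%:R + 1) * (drift T + 1) * (4 * (Kq + 1)).
have D0 : 0 < D.
  have := drift_ge0 T; have := sqrtr_ge0 (dS%:R : R) => h1 h2.
  by rewrite /D !mulr_gt0//; lra.
pose h := e2 / 2 / D.
have h0 : 0 < h by rewrite !divr_gt0.
have /boolp.choice[sel0 selP] (tsz : nat * 'rV[R]_dS * R) : exists a,
    (tsz.1.1 <= T)%N -> controls M tsz.1.1 a /\ (states M tsz.1.1 tsz.1.2 ->
      AV tsz.1.1 tsz.1.2 tsz.2 a <= V tsz.1.1 tsz.1.2 tsz.2 + e2 / 2).
  case: tsz => [[t s'] z] /=.
  have [tT|tT] := boolP (t <= T)%N; last by exists 0.
  have [Ss'|Ss'] := pselect (states M t s'); last first.
    by have [a Aa] := controls_neq0 spec tT; exists a.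
  have [||a Aa ha] := @inf_image_adherent _ _ (controls M t)
      (AV t s' z) lo (e2 / 2) (controls_neq0 spec tT).
  - by move=> a Aa; exact: (action_value_ge spec reg QT LC0 L0 gb gL).
  - by rewrite divr_gt0.
  - exists a => _; split => // _.
    by rewrite /V valueE.
pose sel t s z := sel0 (t, s, z).
have selA t s' z : (t <= T)%N -> controls M t (sel t s' z).
  by move=> tT; have [] := selP (t, s', z) tT.
(* A grid cell that meets the state space is represented by a state inside it; an empty one by an
   arbitrary state, since [rep] must always return a state. *)
have /boolp.choice[rep0 repP] (tk : nat * 'rV[int]_dS) : exists y,
    (tk.1 <= T)%N -> states M tk.1 y /\ forall y', states M tk.1 y' ->
      grid_code h y' = tk.2 -> grid_code h y = tk.2.
  case: tk => t k /=.
  have [tT|tT] := boolP (t <= T)%N; last by exists 0.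
  have [[y Sy yk]|no] := pselect (exists2 y, states M t y & grid_code h y = k).
    by exists y.
  have [y Sy] := states_neq0 spec tT; exists y => _; split => // y' Sy' e'.
  by exfalso; apply: no; exists y'.
pose rep t k := rep0 (t, k).
have repS t k : (t <= T)%N -> states M t (rep t k).
  by move=> tT; have [] := repP (t, k) tT.
have repK t y : (t <= T)%N -> states M t y ->
    grid_code h (rep t (grid_code h y)) = grid_code h y.
  by move=> tT Sy; have [_ /(_ y Sy erefl)] := repP (t, grid_code h y) tT.
exists (proxy_policy h Ss selA repS).
  exact: proxy_policyP.
have opt t (h' : hist (noise M) t) : (t <= T)%N ->
    AV t (state s h' (proxy_ctrls s h sel rep h'))
      (sum_cost s h' (proxy_ctrls s h sel rep h'))
       (proxy_policy_fun s h sel rep h') <=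
    V t (state s h' (proxy_ctrls s h sel rep h'))
      (sum_cost s h' (proxy_ctrls s h sel rep h')) + e2.
  move=> tT.
  have [c1 c2] := proxy_close Ss h0 selA repS repK h' tT.
  have Sh := state_in spec h' tT Ss (proxy_ctrls_admissible s h selA rep h' tT).
  have Sp : states M t (proxy s sel rep (codes s h sel rep h')).1.
    have := @proxy_states s Ss sel rep repS (codes s h sel rep h').
    by rewrite size_codes; apply.
  rewrite /proxy_policy_fun tT /proxy_act size_codes.
  move: Sh Sp c1 c2; set p := proxy _ _ _ _.
  set S := state _ _ _; set z := sum_cost _ _ _ => Sh Sp c1 c2.
  have [Aa ha] := selP (t, p.1, p.2) tT; have {}ha := ha Sp.
  have l1 := hKq t S p.1 z p.2 _ tT Sh Sp Aa.
  have l2 : `|V t S z - V t p.1 p.2| <= Kq * (enorm (S - p.1) + `|z - p.2|).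
    rewrite /V !valueE//.
    apply: (@inf_image_close _ _ _ _ _ lo); first exact: (controls_neq0 spec tT).
    - by move=> a Aa'; exact: (action_value_ge spec reg QT LC0 L0 gb gL).
    - by move=> a Aa'; exact: (action_value_ge spec reg QT LC0 L0 gb gL).
    - by move=> a Aa'; exact: hKq.
  have small : Kq * (enorm (S - p.1) + `|z - p.2|) <= e2 / 4.
    have dle := drift_le tT; have d0 := drift_ge0 t; have sq0 := sqrtr_ge0 (dS%:R : R).
    apply: (@le_trans _ _ (Kq * (2 * (Num.sqrt dS%:R * h * drift t)))).
      by rewrite ler_wpM2l//; lra.
    have -> : e2 / 4 = (D * h) / 2 by rewrite /h; field; rewrite gt_eqF.
    rewrite /D.
    have -> : Kq * (2 * (Num.sqrt dS%:R * h * drift t)) =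
      (Num.sqrt dS%:R * drift t * (4 * Kq)) * h / 2 by field.
    rewrite ler_pM2r ?invr_gt0// ler_pM2r//.
    apply: ler_pM; rewrite ?mulr_ge0//; last by lra.
    by apply: ler_pM; rewrite //; lra.
  move: l1 l2; rewrite !ler_norml -/AV; rewrite /sel in ha *.
  move: ha => /=; set a := sel0 _; lra.
have e2e : e2 + T%:R * e2 = e.
  by rewrite /e2 -[X in X + _]mul1r -mulrDl addrC natr1 mulrC divfK// gt_eqF.
rewrite -e2e addrA.
have lastb (h' : hist (noise M) T) a : admissible M a -> forall b, controls M T b ->
    f (sum_cost s h' a + cost M T (state s h' a) b) =
    g (sum_cost s h' a + cost M T (state s h' a) b).
  move=> aa b Ab; apply: fg.
  have Sh := state_in spec h' (leqnn T) Ss aa.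
  have cz := cost_range spec (leqnn T) Sh Ab.
  have := sum_cost_itv spec h' (leqnn T) Ss aa.
  by rewrite -natr1; lra.
apply: (proxy_expect_le (hi := lo + B) Ss selA repS) => //.
- move=> h' a aa; apply: Rintegral_itv.
  + exact: (measurable_controls reg (leqnn T)).
  + by apply: proxy_policyP.
  by move=> b Ab; rewrite lastb.
- move=> h'.
  have aa := proxy_ctrls_admissible s h selA rep h' (leqnn T).
  have Ab : controls M T (proxy_policy_fun s h sel rep h').
    have := @proxy_act_controls s sel selA rep (codes s h sel rep h').
    by rewrite size_codes /proxy_policy_fun leqnn; exact.
  rewrite /proxy_policy /kdirac.
  rewrite (@Rintegral_dirac_set1 _ _ _ _ _ _ lo (lo + B))//; last first.
  + by move=> b Abb; rewrite lastb.
  + apply: closed_measurable_borel; apply: accessible_closed_set1.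
    by apply: hausdorff_accessible; exact: norm_hausdorff.
  + exact: (measurable_controls reg (leqnn T)).
  rewrite lastb//.
  by have := opt T h' (leqnn T); rewrite /AV /action_value ltnn.
Qed.

End dp_upper.

(** * The optimal risk as an infimum of values *)

Section clip.
Context (R : realType) (c : R).
Hypothesis c0 : 0 <= c.

Definition clip (z : R) : R := Num.max 0 (Num.min z c).

Lemma clip_itv z : 0 <= clip z <= c.
Proof. by rewrite /clip le_max lexx /= ge_max c0 ge_min lexx orbT. Qed.

Lemma clip_id z : 0 <= z <= c -> clip z = z.
Proof. by move=> /andP[z0 zc]; rewrite /clip (min_idPl zc) (max_idPr z0). Qed.

Lemma clip_lip z z' : `|clip z - clip z'| <= `|z - z'|.
Proof.
have cc := c0; rewrite /clip.
have h1 := ler_norm (z - z'); have := ler_norm (- (z - z')); rewrite normrN => h2.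
by case: (leP z c) => h3; case: (leP z' c) => h4;
  case: (leP 0 z) => h5; case: (leP 0 z') => h6;
  case: (leP 0 c) => h7; rewrite ler_norml; lra.
Qed.

End clip.

Section risk.
Context (R : realType) (dTh : nat) (Theta : set 'rV[R]_dTh)
  (f : 'rV[R]_dTh -> R -> R) (T : nat) (LC LTh RTh : R).
Hypothesis fam : risk_family Theta f T LC LTh RTh.

(** The assumptions on [f] hold on [[0, T + 1]] only; clipping extends them to the whole line
    without changing any attainable total cost. *)
Definition clipped (th : 'rV[R]_dTh) (z : R) : R := f th (clip T.+1%:R z).

(** By the Lipschitz bound from 0, all clipped values lie within [LC * (T + 1)] of [f th 0]. The
    width of this range does not depend on [th], so one choice of [lam] and [kap] serves all
    parameters. *)
Definition risk_lo (th : 'rV[R]_dTh) : R := f th 0 - LC * T.+1%:R.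

Definition risk_width : R := 2 * LC * T.+1%:R.

Let c0 : 0 <= T.+1%:R :> R.
Proof. exact: ler0n. Qed.

Lemma risk_LC_ge0 : 0 <= LC.
Proof.
have [th Hth] := Theta_neq0 fam.
have T1 : (1 : R) <= T.+1%:R by rewrite ler1n.
have h1 : (0 : R) <= (1 : R) <= T.+1%:R by apply/andP; split.
have h0 : (0 : R) <= (0 : R) <= T.+1%:R by apply/andP; split.
have := risk_lipschitz fam Hth h1 h0.
by rewrite subr0 normr1 mulr1; exact: (le_trans (normr_ge0 _)).
Qed.

Lemma clipped_id th z : 0 <= z <= T.+1%:R -> f th z = clipped th z.
Proof. by move=> hz; rewrite /clipped clip_id. Qed.

Lemma clipped_lip th z z' : Theta th ->
  `|clipped th z - clipped th z'| <= LC * `|z - z'|.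
Proof.
move=> Hth; apply: le_trans (risk_lipschitz fam Hth _ _) _; [exact: clip_itv..|].
by rewrite ler_wpM2l ?risk_LC_ge0// clip_lip.
Qed.

Lemma clipped_itv th z : Theta th ->
  risk_lo th <= clipped th z <= risk_lo th + risk_width.
Proof.
move=> Hth; have /andP[k0 k1] := clip_itv c0 z.
have h0 : (0 : R) <= (0 : R) <= T.+1%:R by apply/andP; split.
have := risk_lipschitz fam Hth (clip_itv c0 z) h0.
rewrite subr0 (ger0_norm k0) -/(clipped th z) /risk_lo /risk_width.
have := ler_wpM2l risk_LC_ge0 k1; rewrite ler_norml; lra.
Qed.

Lemma clipped_param th th' z : Theta th -> Theta th' ->
  `|clipped th z - clipped th' z| <= LTh * enorm (th - th').
Proof.
by move=> Hth Hth'; apply: (risk_lipschitz_param fam) => //; exact: clip_itv.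
Qed.

(** Boundedness of [Theta] and the Lipschitz bound in the parameter give one lower bound for all
    parameters, so that the infima over [Theta] are genuine. *)
Lemma risk_lo_bounded : exists m, forall th, Theta th -> m <= risk_lo th.
Proof.
have [th0 Hth0] := Theta_neq0 fam; have [x0 hx0] := Theta_radius fam.
exists (f th0 0 - `|LTh| * (2 * RTh) - LC * T.+1%:R) => th Hth.
have h0 : (0 : R) <= (0 : R) <= T.+1%:R by apply/andP; split.
have := risk_lipschitz_param fam Hth Hth0 h0.
have d : enorm (th - th0) <= 2 * RTh.
  apply: le_trans (enorm_triangle x0 _ _) _.
  have := hx0 _ Hth; have := hx0 _ Hth0; rewrite (enorm_distC x0); lra.
have : LTh * enorm (th - th0) <= `|LTh| * (2 * RTh).
  apply: le_trans (ler_norm _) _; rewrite normrM (ger0_norm (enorm_ge0 _)).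
  by rewrite ler_wpM2l.
rewrite /risk_lo ler_norml; lra.
Qed.

Context (dS dA : nat) (M : soc R dS dA) (rad L : R).
Hypotheses (spec : soc_spec M T) (reg : soc_regular M T rad L) (L0 : 0 <= L).
Variable Q : forall t, {measure set (borel (noise M t)) -> \bar R}.
Hypothesis QT : forall t, (t < T)%N -> Q t setT = 1%E.

(** For each parameter the value is the infimum of the expected costs over policies, by the lower
    bound and near-optimality; then the two infima are exchanged. *)
Lemma opt_riskE s : states M 0 s ->
  opt_risk T Theta f Q s = inf [set value T Q (clipped th) 0 s 0 | th in Theta].
Proof.
move=> Ss; have [m mlo] := risk_lo_bounded.
have LC0 := risk_LC_ge0.
have low pol th : policies M T pol -> Theta th ->
    value T Q (clipped th) 0 s 0 <= expected_cost T Q pol (f th) s.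
  move=> polP Hth.
  exact: (value_le_expected_cost spec reg QT LC0 L0
    (fun z => clipped_itv z Hth) (fun z z' => clipped_lip z z' Hth)
    (@clipped_id th) polP).
have vlo th : Theta th -> m <= value T Q (clipped th) 0 s 0.
  move=> Hth; apply: le_trans (mlo _ Hth) _.
  by have /andP[] := value_itv spec reg QT LC0 L0
    (fun z => clipped_itv z Hth) (fun z z' => clipped_lip z z' Hth) 0 (leq0n T) Ss.
have up th e : Theta th -> 0 < e -> exists2 pol : policy M, policies M T pol &
    expected_cost T Q pol (f th) s <= value T Q (clipped th) 0 s 0 + e.
  move=> Hth e0.
  exact: (near_optimal_policy spec reg QT LC0 L0
    (fun z => clipped_itv z Hth) (fun z z' => clipped_lip z z' Hth)
    (@clipped_id th) Ss e0).
have T0 := Theta_neq0 fam; have [th0 Hth0] := T0.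
(* Only supplies a member of [policies M T], so that the infimum over policies is over a nonempty
   set. *)
have [pol0 pol0P _] := up th0 1 Hth0 ltr01.
have rlo pol : policies M T pol -> m <= risk T Theta f Q pol s.
  move=> polP; apply: inf_image_lb => // th Hth.
  exact: le_trans (vlo _ Hth) (low _ _ polP Hth).
apply/eqP; rewrite eq_le; apply/andP; split.
- apply: inf_image_lb => // th Hth; apply/ler_addgt0Pr => e e0.
  have [pol polP h] := up th e Hth e0; apply: le_trans h.
  apply: (@le_trans _ _ (risk T Theta f Q pol s)).
    exact: (inf_image_le (m := m)).
  apply: (inf_image_le (m := m)) => // th' Hth'.
  exact: le_trans (vlo _ Hth') (low _ _ polP Hth').
- apply: inf_image_lb; first by exists pol0.
  move=> pol polP; apply: inf_image_lb => // th Hth.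
  apply: le_trans (low _ _ polP Hth).
  exact: (inf_image_le (m := m)).
Qed.

End risk.

(** * The quadratic potential *)

Lemma Rintegral_affine d (X : measurableType d) (R : realType)
    (mu : {measure set X -> \bar R}) (a b B : R) (y : X -> R) :
  mu setT = 1%E -> measurable_fun setT y -> (forall x, 0 <= y x <= B) ->
  \int[mu]_x (y x + (b * y x ^+ 2 + a)) =
  \int[mu]_x y x + b * \int[mu]_x (y x ^+ 2) + a.
Proof.
move=> mu1 my yB.
have y2B x : 0 <= y x ^+ 2 <= B ^+ 2.
  by have /andP[h1 h2] := yB x; rewrite sqr_ge0/= lerXn2r ?nnegrE// (le_trans h1).
have my2 : measurable_fun setT (fun x => y x ^+ 2) by exact: measurable_funX.
have iy : mu.-integrable setT (EFin \o y).
  by apply: (@bounded_integrable _ _ _ _ _ _ _ _ 0 B).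
have iy2 : mu.-integrable setT (EFin \o (fun x => y x ^+ 2)).
  by apply: (@bounded_integrable _ _ _ _ _ _ _ _ 0 (B ^+ 2)).
have ia : mu.-integrable setT (EFin \o (fun=> a)).
  by apply: (@bounded_integrable _ _ _ _ _ _ _ _ a a) => // x _; rewrite lexx.
have iby2 : mu.-integrable setT (EFin \o (fun x => b * y x ^+ 2)).
  apply: (@bounded_integrable _ _ _ _ _ _ _ _
    (- (`|b| * B ^+ 2)) (`|b| * B ^+ 2)) => //.
    exact: measurable_funM.
  move=> x _; rewrite -ler_norml normrM ler_wpM2l//.
  by have /andP[h1 h2] := y2B x; rewrite ger0_norm.
have ii : mu.-integrable setT (EFin \o (fun x => b * y x ^+ 2 + a)).
  exact: (integrableD measurableT iby2 ia).
rewrite RintegralD//.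
rewrite RintegralD// RintegralZl// Rintegral_cst_prob//; ring.
Qed.

Section potential.
Context (R : realType) (dS dA : nat) (M : soc R dS dA) (T : nat) (rad L : R).
Hypotheses (spec : soc_spec M T) (reg : soc_regular M T rad L).
Variables P Q : forall t, {measure set (borel (noise M t)) -> \bar R}.
Hypothesis PT : forall t, (t < T)%N -> P t setT = 1%E.
Hypothesis QT : forall t, (t < T)%N -> Q t setT = 1%E.
Variables (lo B LC : R) (g : R -> R).
Hypotheses (LC0 : 0 <= LC) (L0 : 0 <= L)
  (gb : forall z, lo <= g z <= lo + B)
  (gL : forall z z', `|g z - g z'| <= LC * `|z - z'|).

(** Built from the true laws [P], hence independent of the samples, although it is later integrated
    against the empirical laws. *)
Definition excess (t : nat) (s : 'rV[R]_dS) (z : R) (a : 'rV[R]_dA)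
  (x : borel (noise M t)) : R :=
  value T P g t.+1 (trans s a x) (z + cost M t s a) - lo.

Let V := value T P g.
Let Vh := value T Q g.

Variables (lam kap : R).
Hypotheses (lam0 : 0 <= lam).
Hypothesis dev : forall t s z a sg, (t < T)%N -> states M t s ->
  0 <= z <= t%:R -> controls M t a -> sg = 1 \/ sg = -1 ->
  sg * (\int[P t]_x excess s z a x - \int[Q t]_x excess s z a x)
  - 2 * lam * (\int[Q t]_x (excess s z a x ^+ 2)
               - (\int[P t]_x excess s z a x) ^+ 2) <= kap.

Let reg_of (W : forall t, {measure set (borel (noise M t)) -> \bar R}) :
  (forall t, (t < T)%N -> W t setT = 1%E) ->
  forall t, (t <= T)%N ->
  exists2 K, 0 <= K & dp_regular M t lo B K LC (value T W g t).
Proof.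
move=> WT t tT; have Lam2 : 2 <= Num.max L 2 by rewrite le_max lexx orbT.
have LLam : L <= Num.max L 2 by rewrite le_max lexx.
have h := value_regular spec reg WT LC0 L0 gb gL Lam2 LLam tT.
eexists; last exact: h.
rewrite mulr_ge0 ?mulr_ge0// exprn_ge0//; apply: le_trans Lam2; lra.
Qed.

Let B0 : 0 <= B.
Proof. by have := gb 0 => /andP[h1 h2]; move: (le_trans h1 h2); rewrite lerDl. Qed.

Lemma excess_measurable t s z a : (t < T)%N -> states M t s -> controls M t a ->
  measurable_fun setT (@excess t s z a).
Proof.
move=> tT Ss Aa; have [K K0 hW] := reg_of PT tT.
apply: measurable_funB => //.
exact: (measurable_next spec (z + cost M t s a) tT K0 hW).
Qed.

Lemma excess_itv t s z a x : (t < T)%N -> states M t s -> controls M t a ->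
  0 <= @excess t s z a x <= B.
Proof.
move=> tT Ss Aa; have [K K0 hW] := reg_of PT tT.
have := next_bounded spec (z + cost M t s a) tT hW Ss Aa x.
rewrite /excess; lra.
Qed.

Lemma mean_excess t s z a : (t < T)%N -> states M t s -> controls M t a ->
  \int[P t]_x excess s z a x =
  \int[P t]_x V t.+1 (trans s a x) (z + cost M t s a) - lo.
Proof.
move=> tT Ss Aa; have [K K0 hW] := reg_of PT tT.
apply: (RintegralDcst (PT tT) (- lo)); last exact: (next_bounded spec _ tT hW).
exact: (measurable_next spec (z + cost M t s a) tT K0 hW).
Qed.

Let next_z t s z a : (t < T)%N -> states M t s -> controls M t a ->
  0 <= z <= t%:R -> 0 <= z + cost M t s a <= t.+1%:R.
Proof.
move=> tT Ss Aa zt; have := cost_range spec (ltnW tT) Ss Aa.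
rewrite -natr1; lra.
Qed.

(* The quadratic term [(V - lo) ^ 2] absorbs the conditional variances of the
   value along the trajectory: this is what saves a factor [T] over the sum of
   the worst one-step deviations. *)
Lemma potential_lower k t s z : (t + k = T)%N -> states M t s -> 0 <= z <= t%:R ->
  V t s z + 2 * lam * (V t s z - lo) ^+ 2 - 2 * lam * B ^+ 2 - k%:R * kap
  <= Vh t s z.
Proof.
have [hlam hB] : 0 <= lam /\ 0 <= B by [].
elim: k t s z => [|k IH] t s z tk Ss zt.
  move: tk; rewrite addn0 => tk; rewrite tk in Ss zt *.
  rewrite /V /Vh !value_last mul0r subr0.
  have [K K0 [hW _]] := reg_of PT (leqnn T).
  have := hW s z Ss; rewrite value_last => h.
  have : (dp_last M T g s z - lo) ^+ 2 <= B ^+ 2.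
    by rewrite lerXn2r ?nnegrE//; lra.
  move=> /(ler_wpM2l hlam); lra.
have tT : (t < T)%N by rewrite -tk addnS ltnS leq_addr.
rewrite /Vh value_step//; apply: inf_image_lb.
  exact: (controls_neq0 spec (ltnW tT)).
move=> a Aa.
have my := excess_measurable z tT Ss Aa.
have yB x := excess_itv z x tT Ss Aa.
(* With [y] the excess, the induction hypothesis says that the next empirical value is at least
   [y + 2 lam y^2 + c]. *)
set c := lo - 2 * lam * B ^+ 2 - k%:R * kap.
have [K' K0' hW'] := reg_of QT tT.
have nb := next_bounded spec (z + cost M t s a) tT hW' Ss Aa.
have step : \int[Q t]_x (excess s z a x + (2 * lam * excess s z a x ^+ 2 + c)) <=
    \int[Q t]_x value T Q g t.+1 (trans s a x) (z + cost M t s a).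
  pose bb := B + 2 * lam * B ^+ 2 + `|c| + `|lo| + `|lo + B|.
  have lB : 0 <= 2 * lam * B ^+ 2 by rewrite !mulr_ge0// sqr_ge0.
  have n1 := normr_ge0 c; have n2 := normr_ge0 lo; have n3 := normr_ge0 (lo + B).
  have n1' := ler_norm c; have n2' := ler_norm lo; have n3' := ler_norm (lo + B).
  have := ler_norm (- c); have := ler_norm (- lo); rewrite !normrN => m1 m2.
  apply: (@le_Rintegral_bounded _ _ _ _ _ _ _ _ _ (- bb) bb) => //.
  - exact: QT.
  - move=> x _; have := yB x => yx.
    have y2 : 0 <= excess s z a x ^+ 2 <= B ^+ 2.
      by rewrite sqr_ge0/= lerXn2r ?nnegrE//; lra.
    have : 0 <= lam * excess s z a x ^+ 2 <= lam * B ^+ 2.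
      by have /andP[? ?] := y2; rewrite mulr_ge0//= ler_wpM2l.
    rewrite /bb; lra.
  - by move=> x _; have := nb x; rewrite /bb; lra.
  - move=> x _.
    have Sx : states M t.+1 (trans s a x) by exact: (trans_states spec).
    have := IH t.+1 _ _ _ Sx (next_z tT Ss Aa zt).
    by rewrite addSnnS => /(_ tk); rewrite /excess /c -/V -/Vh; lra.
apply: le_trans step; rewrite (Rintegral_affine _ _ (QT tT) my yB).
have := dev tT Ss zt Aa (or_introl erefl).
have : V t s z <= \int[P t]_x V t.+1 (trans s a x) (z + cost M t s a).
  have := value_le_action spec reg PT LC0 L0 gb gL z (ltnW tT) Ss Aa.
  by rewrite /action_value tT.
have := mean_excess z tT Ss Aa.
have [K K0 [hW _]] := reg_of PT (ltnW tT).
have := hW s z Ss; rewrite -/V.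
set m := \int[P t]_x V _ _ _ => hV -> Vm.
have sq : (V t s z - lo) ^+ 2 <= (m - lo) ^+ 2.
  by rewrite lerXn2r ?nnegrE//; lra.
have := ler_wpM2l hlam sq.
rewrite /c -natr1; set q := \int[Q t]_x _; set q2 := \int[Q t]_x _; lra.
Qed.

(** Mirror image with [sg = -1], evaluated at a control that is optimal up to [e] for the true laws,
    since attainment is not established. The square is still handled by [V <= m]: it enters with a
    minus sign, and [(V - lo)^2 <= (m - lo)^2]. *)
Lemma potential_upper k t s z : (t + k = T)%N -> states M t s -> 0 <= z <= t%:R ->
  Vh t s z <=
  V t s z - 2 * lam * (V t s z - lo) ^+ 2 + 2 * lam * B ^+ 2 + k%:R * kap.
Proof.
have [hlam hB] : 0 <= lam /\ 0 <= B by [].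
elim: k t s z => [|k IH] t s z tk Ss zt.
  move: tk; rewrite addn0 => tk; rewrite tk in Ss zt *.
  rewrite /V /Vh !value_last mul0r addr0.
  have [K K0 [hW _]] := reg_of PT (leqnn T).
  have := hW s z Ss; rewrite value_last => h.
  have : (dp_last M T g s z - lo) ^+ 2 <= B ^+ 2.
    by rewrite lerXn2r ?nnegrE//; lra.
  move=> /(ler_wpM2l hlam); lra.
have tT : (t < T)%N by rewrite -tk addnS ltnS leq_addr.
apply/ler_addgt0Pr => e e0.
have [||a Aa] := @inf_image_adherent _ _ (controls M t)
  (action_value T P g t s z) lo e (controls_neq0 spec (ltnW tT)).
- by move=> a Aa; exact: (action_value_ge spec reg PT LC0 L0 gb gL _ (ltnW tT)).
- exact: e0.
rewrite -valueE ?(ltnW tT)// /action_value tT -/V => opt.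
have my := excess_measurable z tT Ss Aa.
have yB x := excess_itv z x tT Ss Aa.
set c := lo + 2 * lam * B ^+ 2 + k%:R * kap.
have [K' K0' hW'] := reg_of QT tT.
have nb := next_bounded spec (z + cost M t s a) tT hW' Ss Aa.
have Vhle : Vh t s z <= \int[Q t]_x value T Q g t.+1 (trans s a x) (z + cost M t s a).
  have := value_le_action spec reg QT LC0 L0 gb gL z (ltnW tT) Ss Aa.
  by rewrite /action_value tT.
have step : \int[Q t]_x value T Q g t.+1 (trans s a x) (z + cost M t s a) <=
   \int[Q t]_x (excess s z a x + (- (2 * lam) * excess s z a x ^+ 2 + c)).
  pose bb := B + 2 * lam * B ^+ 2 + `|c| + `|lo| + `|lo + B|.
  have lB : 0 <= 2 * lam * B ^+ 2 by rewrite !mulr_ge0// sqr_ge0.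
  have n1 := normr_ge0 c; have n2 := normr_ge0 lo; have n3 := normr_ge0 (lo + B).
  have n1' := ler_norm c; have n2' := ler_norm lo; have n3' := ler_norm (lo + B).
  have := ler_norm (- c); have := ler_norm (- lo); rewrite !normrN => m1 m2.
  apply: (@le_Rintegral_bounded _ _ _ _ _ _ _ _ _ (- bb) bb) => //.
  - exact: QT.
  - by move=> x _; have := nb x; rewrite /bb; lra.
  - move=> x _; have := yB x => yx.
    have y2 : 0 <= excess s z a x ^+ 2 <= B ^+ 2.
      by rewrite sqr_ge0/= lerXn2r ?nnegrE//; lra.
    have : 0 <= lam * excess s z a x ^+ 2 <= lam * B ^+ 2.
      by have /andP[? ?] := y2; rewrite mulr_ge0//= ler_wpM2l.
    rewrite /bb; lra.
  - move=> x _.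
    have Sx : states M t.+1 (trans s a x) by exact: (trans_states spec).
    have := IH t.+1 _ _ _ Sx (next_z tT Ss Aa zt).
    by rewrite addSnnS => /(_ tk); rewrite /excess /c -/V -/Vh; lra.
apply: le_trans (le_trans Vhle step) _.
rewrite (Rintegral_affine _ _ (QT tT) my yB).
have := dev tT Ss zt Aa (or_intror erefl).
have : V t s z <= \int[P t]_x V t.+1 (trans s a x) (z + cost M t s a).
  have := value_le_action spec reg PT LC0 L0 gb gL z (ltnW tT) Ss Aa.
  by rewrite /action_value tT.
have := mean_excess z tT Ss Aa.
have [K K0 [hW _]] := reg_of PT (ltnW tT).
have := hW s z Ss; rewrite -/V; move: opt.
set m := \int[P t]_x V _ _ _ => opt hV -> Vm.
have sq : (V t s z - lo) ^+ 2 <= (m - lo) ^+ 2.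
  by rewrite lerXn2r ?nnegrE//; lra.
have := ler_wpM2l hlam sq.
rewrite /c -natr1; set q := \int[Q t]_x _; set q2 := \int[Q t]_x _; lra.
Qed.

Lemma value_deviation s : states M 0 s ->
  `|Vh 0 s 0 - V 0 s 0| <= 2 * lam * B ^+ 2 + T%:R * kap.
Proof.
move=> Ss; have [hlam hB] : 0 <= lam /\ 0 <= B by [].
have z0 : (0 : R) <= (0 : R) <= 0%:R by rewrite lexx.
have h1 := potential_lower (add0n T) Ss z0.
have h2 := potential_upper (add0n T) Ss z0.
have : 0 <= lam * (V 0 s 0 - lo) ^+ 2 by rewrite mulr_ge0// sqr_ge0.
rewrite ler_norml; lra.
Qed.

End potential.

(** * Covering numbers and the logarithmic factor *)

Section log_factor.
Context (R : realType).

Lemma expR1_le4 : expR 1 <= 4 :> R.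
Proof.
have h : expR (- (1 / 4)) >= 3 / 4 :> R.
  by apply: le_trans (expR_ge1Dx _); lra.
have -> : 1 = - (4%:R * - (1 / 4)) :> R by field.
rewrite expRN expRM_natl.
have h4 : (3 / 4) ^+ 4 <= expR (- (1 / 4)) ^+ 4 :> R.
  by rewrite lerXn2r ?nnegrE ?expR_ge0//; lra.
have p4 : 0 < (3 / 4) ^+ 4 :> R by rewrite exprn_gt0//; lra.
have : (expR (- (1 / 4)) ^+ 4)^-1 <= ((3 / 4) ^+ 4)^-1 :> R.
  by rewrite lef_pV2 ?posrE ?exprn_gt0 ?expR_gt0//; lra.
by move=> /le_trans; apply; rewrite -invf_ple ?posrE//; lra.
Qed.

Lemma max2_ge2 (x : R) : 2 <= max2 x.
Proof. by rewrite /max2 le_max lexx orbT. Qed.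

Lemma max2_ge (x : R) : x <= max2 x.
Proof. by rewrite /max2 le_max lexx. Qed.

Definition log_bracket (T dA : nat) (LC L eps : R) : R :=
  T%:R ^+ 6 * max2 LC ^+ 3 * max2 L ^+ (T + 1) * dA%:R
  * ln (T%:R ^+ 5 * max2 LC ^+ 2 * max2 L ^+ (T + 2) * max2 eps^-1 ^+ 2)
  * max2 eps^-1 ^+ 3.

(** Parameters truncated at 2 satisfy [x^3 >= 4 x], used for [LC] and [1 / eps], and the inner
    logarithm is at least 1 because its argument is at least 4. The right-hand factor 16 is what
    remains for absolute constants. *)
Lemma log_bracket_ge (T dA : nat) (LC L eps : R) : (0 < T)%N -> (0 < dA)%N ->
  16 * (T%:R ^+ 2 * max2 LC * max2 L ^+ (T + 1) * max2 eps^-1) <=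
  log_bracket T dA LC L eps.
Proof.
move=> T0 dA0; rewrite /log_bracket.
have := max2_ge2 LC; have := max2_ge2 L; have := max2_ge2 eps^-1.
move: (max2 LC) (max2 L) (max2 eps^-1) => l Lam e e2 L2 l2.
have T1 : 1 <= T%:R :> R by rewrite ler1n.
have dA1 : 1 <= dA%:R :> R by rewrite ler1n.
have Lk k : 1 <= Lam ^+ k by apply: exprn_ege1; lra.
set arg := T%:R ^+ 5 * _ * _ * _.
have sq2 (x : R) : 2 <= x -> 4 <= x ^+ 2 by move=> h; rewrite expr2; nra.
have arg4 : 4 <= arg.
  rewrite /arg -[4 in leLHS]mulr1; apply: ler_pM;
    rewrite ?mulr_ge0 ?exprn_ge0//; try lra.
    rewrite -[4]mul1r -[1 * 4]mulr1; apply: ler_pM => //.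
    by apply: ler_pM => //; [exact: exprn_ege1 | exact: sq2].
  by apply: exprn_ege1; lra.
have ln1 : 1 <= ln arg.
  rewrite -[leLHS](@expRK R) ler_ln ?posrE ?expR_gt0 ?(le_trans expR1_le4)//; lra.
set Y := ln arg in ln1 *.
have -> : 16 * (T%:R ^+ 2 * l * Lam ^+ (T + 1) * e) =
   ((T%:R ^+ 2 * (4 * l)) * Lam ^+ (T + 1) * 1 * 1) * (4 * e) by ring.
have hl : 4 * l <= l ^+ 3 by rewrite exprS mulrC ler_wpM2l ?sq2//; lra.
have he : 4 * e <= e ^+ 3 by rewrite exprS mulrC ler_wpM2l ?sq2//; lra.
have L0 : 0 <= Lam ^+ (T + 1) by apply: le_trans (Lk _).
have T2 : T%:R ^+ 2 <= T%:R ^+ 6 :> R by rewrite ler_weXn2l.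
have T20 : 0 <= T%:R ^+ 2 :> R by exact: exprn_ge0.
do ![apply: ler_pM => //; rewrite ?mulr_ge0//; try lra].
Qed.

(** The exponential is the eighth power of the argument of the logarithm. All its bases are at least
    1, so the power only increases them, and the excess over each net base absorbs the numerical
    constants, as well as the 2 for the two signs. *)
Lemma log_factor_exp (T dS dA dTh : nat)
    (LC L rad LTh RTh eps delta bS bz bTh : R) :
  (0 < T)%N -> (0 < dA)%N -> 0 < eps -> 0 < delta < 1 ->
  let Br := log_bracket T dA LC L eps in
  0 <= bS -> bS <= max2 rad * Br ^+ 2 -> 0 <= bz -> bz <= Br ^+ 2 ->
  0 <= bTh -> bTh <= max2 (LTh * RTh / eps) ^+ 8 ->
  T%:R * (bTh ^+ dTh * (bS ^+ dS * (bS ^+ dA * (bz * 2)))) / delta <=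
  expR (8 * log_factor T dS dA dTh LC L rad LTh RTh eps delta).
Proof.
move=> T0 dA0 eps0 /andP[d0 d1] Br bS0 bSle bz0 bzle bTh0 bThle.
have Br16 := log_bracket_ge LC L eps T0 dA0; rewrite -/Br in Br16.
rewrite /log_factor -/(log_bracket T dA LC L eps) -/Br.
have T1 : 1 <= T%:R :> R by rewrite ler1n.
have Br2 : 2 <= Br.
  apply: le_trans Br16.
  have := max2_ge2 LC; have := max2_ge2 L; have := max2_ge2 eps^-1.
  move: (max2 LC) (max2 L) (max2 eps^-1) => l Lam e e2 L2 l2.
  have h1 : 1 <= T%:R ^+ 2 * l * Lam ^+ (T + 1) * e.
    have a1 : 1 <= T%:R ^+ 2 :> R by exact: exprn_ege1.
    have a2 : 1 <= Lam ^+ (T + 1) by apply: exprn_ege1; lra.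
    rewrite -[1]mulr1; apply: ler_pM => //; last lra.
    rewrite -[1]mulr1; apply: ler_pM => //.
    by rewrite -[1]mulr1; apply: ler_pM => //; lra.
  lra.
have Br1 : 1 <= Br by lra.
have r2 := max2_ge2 rad; have q2 := max2_ge2 (LTh * RTh / eps).
move: (max2 rad) (max2 (LTh * RTh / eps)) r2 q2 bSle bThle => r q r2 q2 bSle bThle.
clearbody Br; clear Br16.
have r1 : 1 <= r by lra. have q1 : 1 <= q by lra.
have pos : 0 < T%:R ^+ 2 * Br ^+ (dS + dA + 1) * r ^+ (dS + dA) * q ^+ dTh / delta.
  by rewrite divr_gt0// !mulr_gt0 ?exprn_gt0//; lra.
rewrite -[8]/(8%:R) expRM_natl lnK ?posrE//.
have di : 1 <= delta^-1 by rewrite invf_ge1// ltW.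
have -> : (T%:R ^+ 2 * Br ^+ (dS + dA + 1) * r ^+ (dS + dA) * q ^+ dTh / delta) ^+ 8 =
  (T%:R ^+ 16 * ((q ^+ 8) ^+ dTh * ((r ^+ 8 * Br ^+ 8) ^+ dS *
     ((r ^+ 8 * Br ^+ 8) ^+ dA * (Br ^+ 2 * Br ^+ 6))))) * delta^-1 ^+ 8.
  have E (x : R) k : (x ^+ k) ^+ 8 = (x ^+ 8) ^+ k by rewrite -!exprM mulnC.
  have -> : Br ^+ 2 * Br ^+ 6 = Br ^+ 8 by rewrite -exprD.
  do 4 rewrite [in LHS]exprMn.
  rewrite (E q dTh) (E r (dS + dA)%N) (E Br (dS + dA + 1)%N).
  set q8 := q ^+ 8; set r8 := r ^+ 8; set B8 := Br ^+ 8.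
  clearbody q8 r8 B8; rewrite !exprMn !exprD; ring.
have mono (x y : R) k : 0 <= x -> x <= y -> x ^+ k <= y ^+ k.
  by move=> x0 xy; rewrite lerXn2r ?nnegrE// (le_trans x0).
have bSle' : bS <= r ^+ 8 * Br ^+ 8.
  apply: le_trans bSle _; apply: ler_pM => //; rewrite ?exprn_ge0//; try lra.
    by rewrite -[leLHS]expr1 ler_weXn2l.
  by rewrite ler_weXn2l.
have p (x : R) k : 0 <= x -> 0 <= x ^+ k by move=> ?; exact: exprn_ge0.
have Br6 : 2 <= Br ^+ 6.
  by apply: le_trans Br2 _; rewrite -[leLHS]expr1 ler_weXn2l.
have hB : bz * 2 <= Br ^+ 2 * Br ^+ 6 by apply: ler_pM.
apply: ler_pM; rewrite ?mulr_ge0 ?p ?invr_ge0//; try lra; last first.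
  by rewrite -[leLHS]expr1 ler_weXn2l.
apply: ler_pM; rewrite ?mulr_ge0 ?p//; first by rewrite -[leLHS]expr1 ler_weXn2l.
apply: ler_pM; rewrite ?mulr_ge0 ?p//; first exact: mono.
apply: ler_pM; rewrite ?mulr_ge0 ?p//; first exact: mono.
by apply: ler_pM; rewrite ?mulr_ge0 ?p//; first exact: mono.
Qed.

End log_factor.

(** * Net sizes against the bases of the logarithmic factor *)

Section net_sizes.
Context (R : realType).

Lemma has_radius_ge0 d (A : set 'rV[R]_d) r : A !=set0 -> has_radius A r -> 0 <= r.
Proof. by move=> [a Aa] [x0 h]; exact: le_trans (enorm_ge0 _) (h _ Aa). Qed.

Lemma interval_net (c eta : R) : 0 <= c -> 0 < eta ->
  exists s : seq R, (size s)%:R <= c / eta + 1 /\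
    forall z, 0 <= z <= c -> exists2 y, y \in s & `|z - y| <= eta.
Proof.
move=> c0 eta0; pose K := Num.truncn (c / eta).
exists [seq i%:R * eta | i <- iota 0 K.+1]; split.
  rewrite size_map size_iota -natr1 lerD2r truncn_le//.
  by rewrite divr_ge0// ltW.
move=> z /andP[z0 zc]; exists ((Num.truncn (z / eta))%:R * eta).
  apply/mapP; exists (Num.truncn (z / eta)) => //.
  rewrite mem_iota /= add0n ltnS le_truncn// ler_pM2r ?invr_gt0//.
have h1 : (Num.truncn (z / eta))%:R <= z / eta.
  by rewrite truncn_le// divr_ge0// ltW.
have h2 : z / eta < (Num.truncn (z / eta))%:R + 1.
  by rewrite natr1 truncnS_gt.
move: h1 h2; rewrite ler_pdivlMr// ltr_pdivrMr// mulrDl mul1r ler_norml; lra.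
Qed.

(** If [LTh <= 0], one parameter suffices. Otherwise the mesh is [eps / (8 LTh)] and, with
    [q = LTh * RTh / eps], the base [2 e (8 q + 2)] is at most [64 q + 16 <= 72 max2 q]. *)
Lemma param_net d (Theta : set 'rV[R]_d) (LTh RTh eps : R) :
  Theta !=set0 -> has_radius Theta RTh -> 0 < eps ->
  exists s : seq 'rV[R]_d,
    [/\ forall th, th \in s -> Theta th,
        (size s)%:R <= (72 * max2 (LTh * RTh / eps)) ^+ d &
        forall th, Theta th -> exists2 th', th' \in s &
          LTh * enorm (th - th') <= eps / 8].
Proof.
move=> Th0 Thr eps0; have [LTh0|LTh0] := leP LTh 0.
  have [th Hth] := Th0; exists [:: th]; split.
  - by move=> th'; rewrite inE => /eqP ->.
  - by apply: exprn_ege1; have := max2_ge2 (LTh * RTh / eps); lra.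
  - move=> th' Hth'; exists th; first exact: mem_head.
    apply: (@le_trans _ _ 0); last by rewrite divr_ge0// ltW.
    by rewrite mulr_le0_ge0// enorm_ge0.
have eta0 : 0 < eps / (8 * LTh) by rewrite divr_gt0// mulr_gt0.
have [s [h1 h2 h3]] := euclidean_net Th0 Thr eta0.
have R0 := has_radius_ge0 Th0 Thr.
exists s; split => //.
  apply: le_trans h2 _; set q := LTh * RTh / eps.
  have q0 : 0 <= q by rewrite divr_ge0 ?mulr_ge0// ltW.
  have -> : RTh / (eps / (8 * LTh)) = 8 * q.
    by rewrite /q; field; rewrite !gt_eqF.
  have e4 := expR1_le4 R; have e0 := expR_ge0 (1 : R).
  have m1 := max2_ge2 q; have m2 := max2_ge q.
  rewrite lerXn2r ?nnegrE ?mulr_ge0//; try lra.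
  have h0 : 0 <= 8 * q + 2 by lra.
  have := ler_wpM2r h0 e4; lra.
move=> th /h3 [th' Hth' hd]; exists th' => //.
apply: le_trans (ler_wpM2l (ltW LTh0) hd) _.
by rewrite le_eqVlt; apply/orP; left; apply/eqP; field; rewrite gt_eqF.
Qed.

Lemma param_net_base_le (q : R) : 72 * max2 q <= max2 q ^+ 8.
Proof.
have m2 := max2_ge2 q; move: (max2 q) m2 => m m2.
rewrite exprSr ler_wpM2r//; first lra.
apply: (@le_trans _ _ (2 ^+ 7)); first lra.
by rewrite lerXn2r ?nnegrE//; lra.
Qed.

Section scales.
Variables (T dA : nat) (LC L rad eps : R).
Hypotheses (T0 : (0 < T)%N) (dA0 : (0 < dA)%N) (eps0 : 0 < eps) (LC0 : 0 < LC)
  (rad0 : 0 <= rad).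

Let Br := log_bracket T dA LC L eps.
Let X := T%:R ^+ 2 * max2 LC * max2 L ^+ (T + 1) * max2 eps^-1.

Let X16 : 16 <= X.
Proof.
rewrite /X; have := max2_ge2 LC; have := max2_ge2 L; have := max2_ge2 eps^-1.
move: (max2 LC) (max2 L) (max2 eps^-1) => l Lam e e2 L2 l2.
have T1 : 1 <= T%:R :> R by rewrite ler1n.
have T21 : 1 <= T%:R ^+ 2 :> R by exact: exprn_ege1.
have Lam4 : 4 <= Lam ^+ (T + 1).
  apply: (@le_trans _ _ (Lam ^+ 2)); first by rewrite expr2; nra.
  by rewrite ler_weXn2l ?addn1 ?ltnS//; lra.
have -> : 16 = 1 * 2 * 4 * 2 :> R by ring.
by do ![apply: ler_pM => //; rewrite ?mulr_ge0//].
Qed.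

Let BrX : 4096 * X <= Br ^+ 2.
Proof.
have h := log_bracket_ge LC L eps T0 dA0; rewrite -/X -/Br in h.
have x16 := X16; apply: (@le_trans _ _ ((16 * X) ^+ 2)).
  by rewrite expr2; nra.
by rewrite lerXn2r ?nnegrE//; lra.
Qed.

Let LCeps : LC / eps <= max2 LC * max2 eps^-1.
Proof.
by apply: ler_pM; rewrite ?max2_ge// ?invr_ge0 ltW.
Qed.

(** The scales [40] and [12] combine to [480]; with [e <= 4] the base is at most
    [(3840 + 16) * max2 rad * X], below the [4096 * X] available in [Br^2]. *)
Lemma state_net_base_le :
  2 * expR 1 * (rad / (eps / (40 * T%:R) / (12 * LC * max2 L ^+ (T + 1))) + 2)
  <= max2 rad * Br ^+ 2.
Proof.
have Tpos : 0 < T%:R :> R by rewrite ltr0n.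
have T1 : 1 <= T%:R :> R by rewrite ler1n.
have L2 := max2_ge2 L; have Lp : 0 < max2 L ^+ (T + 1) by rewrite exprn_gt0//; lra.
have -> : rad / (eps / (40 * T%:R) / (12 * LC * max2 L ^+ (T + 1))) =
   480 * (rad * (T%:R * (LC / eps) * max2 L ^+ (T + 1))).
  by field; rewrite !gt_eqF.
have hX : T%:R * (LC / eps) * max2 L ^+ (T + 1) <= X.
  have -> : X = T%:R ^+ 2 * (max2 LC * max2 eps^-1) * max2 L ^+ (T + 1).
    by rewrite /X; ring.
  rewrite ler_wpM2r ?(ltW Lp)//; apply: ler_pM => //.
  - by rewrite divr_ge0// ltW.
  - by rewrite expr2 ler_peMr// ltW.
have hY0 : 0 <= T%:R * (LC / eps) * max2 L ^+ (T + 1).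
  by rewrite !mulr_ge0// ?(ltW Lp)// ?invr_ge0 ltW.
have r2 := max2_ge2 rad; have rle := max2_ge rad.
have hrX : rad * (T%:R * (LC / eps) * max2 L ^+ (T + 1)) <= max2 rad * X.
  exact: ler_pM.
have e4 := expR1_le4 R; have e0 := expR_ge0 (1 : R).
have x16 := X16; have bx := BrX.
move: hrX hX hY0; set Y := T%:R * _ * _ => hrX hX hY0.
have rY0 : 0 <= rad * Y by rewrite mulr_ge0.
have h0 : 0 <= 480 * (rad * Y) + 2 by lra.
have h := ler_wpM2r h0 e4.
have rX : 1 <= max2 rad * X by rewrite -[1]mulr1; apply: ler_pM => //; lra.
have r0 : 0 <= max2 rad by lra.
have := ler_wpM2l r0 bx; lra.
Qed.

Lemma cost_net_size_le :
  T.+1%:R / (eps / (40 * T%:R) / (2 * LC)) + 1 <= Br ^+ 2.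
Proof.
have Tpos : 0 < T%:R :> R by rewrite ltr0n.
have T1 : 1 <= T%:R :> R by rewrite ler1n.
have -> : T.+1%:R / (eps / (40 * T%:R) / (2 * LC)) =
   80 * (T.+1%:R * T%:R * (LC / eps)).
  by field; rewrite !gt_eqF.
have x16 := X16; have bx := BrX.
have L2 := max2_ge2 L; have Lp : 1 <= max2 L ^+ (T + 1).
  by apply: exprn_ege1; lra.
have hX : T.+1%:R * T%:R * (LC / eps) <= 2 * X.
  have -> : 2 * X = (2 * T%:R) * T%:R * (max2 LC * max2 eps^-1) * max2 L ^+ (T + 1).
    by rewrite /X; ring.
  rewrite -[leLHS]mulr1; apply: ler_pM => //.
    by rewrite !mulr_ge0// ?invr_ge0 ltW.
  apply: ler_pM => //.
    by rewrite divr_ge0// ltW.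
  by rewrite ler_wpM2r// -natr1; lra.
lra.
Qed.

End scales.
End net_sizes.

Section union_bound.
Context d (Omega : measurableType d) (R : realType) (Pr : probability Omega R).

(** The good set quantifies over uncountably many states and functions and may be non-measurable;
    only a measurable set covering its complement is required. *)
Definition mostly (p : R) (good : set Omega) :=
  exists E : set Omega,
    [/\ measurable E, (Pr E <= p%:E)%E & forall w, ~ E w -> good w].

Lemma mostly_impl p p' (A B : set Omega) : p <= p' -> A `<=` B ->
  mostly p A -> mostly p' B.
Proof.
move=> pp' AB [E [mE PE EA]]; exists E; split => //.
  by apply: le_trans PE _; rewrite lee_fin.
by move=> w /EA /AB.
Qed.

Lemma mostly_forall_seq (I : eqType) (s : seq I) (K p : R)
    (good : I -> set Omega) : 0 <= p -> (size s)%:R <= K ->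
  (forall i, i \in s -> mostly p (good i)) ->
  mostly (K * p) [set w | forall i, i \in s -> good i w].
Proof.
move=> p0 sK h.
suff : mostly ((size s)%:R * p) [set w | forall i, i \in s -> good i w].
  by apply: mostly_impl => //; rewrite ler_wpM2r.
elim: s {sK} h => [_|i s IH h].
  exists set0; split; rewrite ?mul0r ?measure0//.
have [E [mE PE EA]] := h i (mem_head _ _).
have [|F [mF PF FA]] := IH.
  by move=> j js; apply: h; rewrite inE js orbT.
exists (E `|` F); split; first exact: measurableU.
  rewrite /= -nat1r mulrDl mul1r EFinD.
  by apply: le_trans (measureU2 _ _ _) _ => //; exact: leeD.
move=> w /not_orP[nE nF] j; rewrite inE => /orP[/eqP ->|js]; first exact: EA.
exact: FA.
Qed.

End union_bound.

(** * Deviation of the optimal risk *)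

Section value_close.
Context (R : realType) (dS dA : nat) (M : soc R dS dA) (T : nat) (rad L : R).
Hypotheses (spec : soc_spec M T) (reg : soc_regular M T rad L).
Variable Q : forall t, {measure set (borel (noise M t)) -> \bar R}.
Hypothesis QT : forall t, (t < T)%N -> Q t setT = 1%E.
Variables (lo lo' B LC e : R) (g g' : R -> R).
Hypotheses (LC0 : 0 <= LC) (L0 : 0 <= L)
  (gb : forall z, lo <= g z <= lo + B)
  (gL : forall z z', `|g z - g z'| <= LC * `|z - z'|)
  (gb' : forall z, lo' <= g' z <= lo' + B)
  (gL' : forall z z', `|g' z - g' z'| <= LC * `|z - z'|)
  (gg' : forall z, `|g z - g' z| <= e).

(** Averages and infima are nonexpansive in the uniform distance, so the perturbation of the
    terminal function is not amplified by the backward steps. *)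
Lemma value_close k t s z : (t + k = T)%N -> states M t s ->
  `|value T Q g t s z - value T Q g' t s z| <= e.
Proof.
elim: k t s z => [|k IH] t s z tk Ss.
  move: tk; rewrite addn0 => tk; rewrite tk in Ss *; rewrite !value_last.
  apply: (inf_image_close (m := Num.min lo lo')) => //.
  - exact: (controls_neq0 spec).
  - by move=> a Aa; rewrite ge_min; case/andP: (gb (z + cost M T s a)) => ->.
  - move=> a Aa; rewrite ge_min orbC.
    by case/andP: (gb' (z + cost M T s a)) => ->.
have tT : (t < T)%N by rewrite -tk addnS ltnS leq_addr.
have Lam2 : 2 <= Num.max L 2 by rewrite le_max lexx orbT.
have LLam : L <= Num.max L 2 by rewrite le_max lexx.
have hW := value_regular spec reg QT LC0 L0 gb gL Lam2 LLam tT.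
have hW' := value_regular spec reg QT LC0 L0 gb' gL' Lam2 LLam tT.
have Kp : 0 <= 2 * LC * Num.max L 2 ^+ (T - t.+1).+1.
  by rewrite !mulr_ge0// exprn_ge0//; apply: le_trans Lam2; lra.
rewrite !(value_step _ _ tT); apply: (inf_image_close (m := Num.min lo lo')).
- exact: (controls_neq0 spec (ltnW tT)).
- move=> a Aa; rewrite ge_min.
  by case/andP: (mean_next_itv spec QT (z + cost M t s a) tT hW Ss Aa) => ->.
- move=> a Aa; rewrite ge_min orbC.
  by case/andP: (mean_next_itv spec QT (z + cost M t s a) tT hW' Ss Aa) => ->.
move=> a Aa.
have nb := next_bounded spec (z + cost M t s a) tT hW Ss Aa.
have nb' := next_bounded spec (z + cost M t s a) tT hW' Ss Aa.
apply: (@Rintegral_close _ _ _ _ _ _ _ _ (Num.min lo lo')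
  (Num.max (lo + B) (lo' + B))).
- exact: QT.
- exact: (measurable_next spec _ tT Kp hW Ss Aa).
- exact: (measurable_next spec _ tT Kp hW' Ss Aa).
- by move=> x; have /andP[h1 h2] := nb x; rewrite ge_min le_max h1 h2.
- by move=> x; have /andP[h1 h2] := nb' x; rewrite ge_min le_max h1 h2 !orbT.
- move=> x; apply: IH; first by rewrite addSnnS.
  exact: (trans_states spec).
Qed.

End value_close.

(** * Uniform deviation over nets of states, controls and costs *)

Section sampled.
Context (R : realType) (dS dA : nat) (M : soc R dS dA) (T : nat) (rad L : R).
Hypotheses (spec : soc_spec M T) (reg : soc_regular M T rad L).
Variables (lo B LC : R) (g : R -> R).
Hypotheses (LC0 : 0 < LC) (L0 : 0 <= L)
  (gb : forall z, lo <= g z <= lo + B)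
  (gL : forall z z', `|g z - g z'| <= LC * `|z - z'|).
Context (n : nat) (d : measure_display) (Omega : measurableType d)
  (Pr : probability Omega R) (xi : forall t, nat -> Omega -> borel (noise M t)).
Hypotheses (n0 : (0 < n)%N) (xiP : iid_samples (noise_law M) T n Pr xi).
Variables (lam kap eta : R).
Hypotheses (lam0 : 0 < lam) (lamB : lam * B <= 16^-1) (eta0 : 0 < eta).

Let P t : {measure set (borel (noise M t)) -> \bar R} := noise_law M t.
Let Phat w t := empirical R n (fun i => xi t i w).

Let PT t : (t < T)%N -> P t setT = 1%E.
Proof. by move=> _; exact: probability_setT. Qed.

Let PhatT w t : (t < T)%N -> Phat w t setT = 1%E.
Proof. by move=> _; exact: empirical_setT. Qed.

Let Lam := max2 L.
Let p := expR (- (n%:R * lam * kap / 2)).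
Let etaS := eta / (12 * LC * Lam ^+ (T + 1)).
Let bS := 2 * expR 1 * (rad / etaS + 2).
Let bz := T.+1%:R / (eta / (2 * LC)) + 1.

Let deviation t (y : borel (noise M t) -> R) sg w :=
  sg * (\int[P t]_x y x - \int[Phat w t]_x y x)
    - 2 * lam * (\int[Phat w t]_x (y x ^+ 2) - (\int[P t]_x y x) ^+ 2).

Let p0 : 0 <= p. Proof. exact: expR_ge0. Qed.

Let Lam2 : 2 <= Lam. Proof. exact: max2_ge2. Qed.

Let den0 : 0 < 12 * LC * Lam ^+ (T + 1).
Proof.
by rewrite mulr_gt0 ?mulr_gt0// exprn_gt0//; apply: lt_le_trans Lam2.
Qed.

Let etaS0 : 0 < etaS. Proof. by rewrite divr_gt0. Qed.

Lemma mostly_deviation t s z a sg : (t < T)%N -> states M t s -> controls M t a ->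
  `|sg| <= 1 ->
  mostly Pr p [set w | forall y : borel (noise M t) -> R, measurable_fun setT y ->
    (forall x, 0 <= y x <= B) ->
    (forall x, `|y x - excess T P lo g s z a x| <= eta) ->
    @deviation t y sg w <= kap + 5 * eta].
Proof.
move=> tT Ss Aa sg1.
have my := excess_measurable spec reg PT (ltW LC0) L0 gb gL z tT Ss Aa.
have yB x := excess_itv spec reg PT (ltW LC0) L0 gb gL z x tT Ss Aa.
exact: (sample_deviation1 xiP n0 kap tT eta0 lam0 lamB my yB sg1).
Qed.

(** The excess has modulus at most [3 LC Lam^(T+1)] in state and control. Two displacements
    [etaS = eta / (12 LC Lam^(T+1))] contribute [eta / 2], and the cost mesh [eta / (2 LC)] the
    other half. *)
Lemma excess_close t s s' z z' a a' x : (t < T)%N -> states M t s ->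
  controls M t a -> states M t s' -> controls M t a' ->
  enorm (s - s') <= etaS -> enorm (a - a') <= etaS ->
  `|z - z'| <= eta / (2 * LC) ->
  `|@excess _ _ _ M T P lo g t s z a x - excess T P lo g s' z' a' x| <= eta.
Proof.
move=> tT Ss Aa Ss' Aa' hs ha hz.
have LLam : L <= Lam by exact: max2_ge.
have hW := value_regular spec reg PT (ltW LC0) L0 gb gL Lam2 LLam tT.
have hLC := LC0; have hLam := Lam2; have hL := L0.
have Kp : 0 <= 2 * LC * Lam ^+ (T - t.+1).+1.
  by rewrite !mulr_ge0// ?(ltW LC0)// exprn_ge0//; lra.
have := next_close spec reg (ltW LC0) L0 z z' tT Kp hW Ss Aa Ss' Aa' x.
have subBB (u v : R) : u - lo - (v - lo) = u - v by ring.
rewrite /excess subBB => h.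
apply: le_trans h _.
have G : 2 * LC * Lam ^+ (T - t.+1).+1 * L + LC * L <= 3 * LC * Lam ^+ (T + 1).
  have h1 : Lam ^+ (T - t.+1).+1 * L <= Lam ^+ (T + 1).
    apply: (@le_trans _ _ (Lam ^+ (T - t.+1).+1 * Lam)).
      by rewrite ler_wpM2l// exprn_ge0//; lra.
    rewrite -exprSr ler_weXn2l ?addn1 ?ltnS//; first by lra.
    by rewrite subnSK// leq_subr.
  have h2 : L <= Lam ^+ (T + 1).
    by apply: le_trans LLam _; rewrite addn1 exprS ler_peMr ?exprn_ege1//; lra.
  have := ler_wpM2l (ltW hLC) h1; have := ler_wpM2l (ltW hLC) h2; lra.
have G0 : 0 <= 2 * LC * Lam ^+ (T - t.+1).+1 * L + LC * L.
  by rewrite addr_ge0// mulr_ge0// ltW.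
have hsa : enorm (s - s') + enorm (a - a') <= 2 * etaS by lra.
have e0 : 0 <= enorm (s - s') + enorm (a - a') by rewrite addr_ge0// enorm_ge0.
have h1 := ler_pM G0 e0 G hsa.
have h2 := ler_wpM2l (ltW hLC) hz.
have e1 : 3 * LC * Lam ^+ (T + 1) * (2 * etaS) = eta / 2.
  rewrite /etaS; have := den0; move: (Lam ^+ (T + 1)) => l; rewrite pmulr_rgt0 => [l0|].
    by field; rewrite !gt_eqF.
  by rewrite mulr_gt0.
have e2 : LC * (eta / (2 * LC)) = eta / 2 by field; rewrite gt_eqF.
lra.
Qed.

(** The event attached to a net point is good for every function within [eta] of its excess, hence
    for the excess at each nearby triple. The factor 2 counts the signs. *)
Lemma mostly_deviation_uniform t : (t < T)%N ->
  mostly Pr (bS ^+ dS * (bS ^+ dA * (bz * (2 * p))))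
   [set w | forall s z a sg, states M t s -> 0 <= z <= t%:R -> controls M t a ->
      sg = 1 \/ sg = -1 -> @deviation t (excess T P lo g s z a) sg w <= kap + 5 * eta].
Proof.
move=> tT; have rad0 := has_radius_ge0 (states_neq0 spec (ltnW tT))
  (states_radius reg (ltnW tT)).
have [NS [NS1 NS2 NS3]] := euclidean_net (states_neq0 spec (ltnW tT))
  (states_radius reg (ltnW tT)) etaS0.
have [NA [NA1 NA2 NA3]] := euclidean_net (controls_neq0 spec (ltnW tT))
  (controls_radius reg (ltnW tT)) etaS0.
have etaz0 : 0 < eta / (2 * LC) by rewrite divr_gt0// mulr_gt0.
have [Nz [Nz1 Nz2]] := interval_net (ler0n R T.+1) etaz0.
have bS0 : 0 <= bS.
  by rewrite !mulr_ge0 ?expR_ge0// addr_ge0// divr_ge0// ltW.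
have bz0 : 0 <= bz by apply: le_trans Nz1; exact: ler0n.
have q1 : 0 <= bz * (2 * p) by rewrite !mulr_ge0.
have q2 : 0 <= bS ^+ dA * (bz * (2 * p)) by rewrite mulr_ge0// exprn_ge0.
have h : mostly Pr (bS ^+ dS * (bS ^+ dA * (bz * (2 * p))))
  [set w | forall s, s \in NS -> forall a, a \in NA -> forall z, z \in Nz ->
    forall sg, sg \in [:: 1; -1] ->
    forall y : borel (noise M t) -> R, measurable_fun setT y ->
    (forall x, 0 <= y x <= B) ->
    (forall x, `|y x - excess T P lo g s z a x| <= eta) ->
    @deviation t y sg w <= kap + 5 * eta].
  apply: (mostly_forall_seq q2 NS2) => s /NS1 Ss.
  apply: (mostly_forall_seq q1 NA2) => a /NA1 Aa.
  apply: (mostly_forall_seq _ Nz1) => [|z _]; first by rewrite mulr_ge0.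
  apply: (mostly_forall_seq p0) => [//|sg].
  rewrite !inE => hsg; apply: mostly_deviation => //.
  by case/orP: hsg => /eqP ->; rewrite ?normrN normr1.
apply: mostly_impl h => // w /= h s z a sg Ss hz Aa hsg.
have [s' Hs' hs] := NS3 s Ss; have [a' Ha' ha] := NA3 a Aa.
have zT : 0 <= z <= T.+1%:R.
  have /andP[-> /= zt] := hz; apply: le_trans zt _.
  by rewrite ler_nat; exact: ltnW (leqW tT).
have [z' Hz' hzz] := Nz2 z zT.
have sgin : sg \in [:: 1; -1] by rewrite !inE; case: hsg => ->; rewrite eqxx ?orbT.
apply: (h s' Hs' a' Ha' z' Hz' sg sgin).
- exact: (excess_measurable spec reg PT (ltW LC0) L0 gb gL z tT Ss Aa).
- move=> x; exact: (excess_itv spec reg PT (ltW LC0) L0 gb gL z x tT Ss Aa).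
- by move=> x; apply: excess_close => //; [exact: NS1 | exact: NA1].
Qed.

Lemma mostly_value_deviation :
  mostly Pr (T%:R * (bS ^+ dS * (bS ^+ dA * (bz * (2 * p)))))
   [set w | forall s, states M 0 s ->
      `|value T (Phat w) g 0 s 0 - value T P g 0 s 0| <=
      2 * lam * B ^+ 2 + T%:R * (kap + 5 * eta)].
Proof.
have rad0 := has_radius_ge0 (states_neq0 spec (leq0n T)) (states_radius reg (leq0n T)).
have q : 0 <= bS ^+ dS * (bS ^+ dA * (bz * (2 * p))).
  have bS0 : 0 <= bS.
    by rewrite !mulr_ge0 ?expR_ge0// addr_ge0// divr_ge0// ltW.
  have bz0 : 0 <= bz by rewrite addr_ge0// divr_ge0// divr_ge0 ?mulr_ge0// ltW.
  by rewrite !mulr_ge0// exprn_ge0.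
have sz : (size (enum 'I_T))%:R <= T%:R :> R by rewrite size_enum_ord.
have h := mostly_forall_seq q sz
  (fun (t : 'I_T) _ => mostly_deviation_uniform (ltn_ord t)).
apply: mostly_impl h => // w /= h s Ss.
apply: (value_deviation spec reg PT (PhatT w) (ltW LC0) L0 gb gL (ltW lam0)) => //.
move=> t s' z a sg tT Ss' hz Aa hsg.
exact: (h (Ordinal tT) (mem_enum _ _) s' z a sg Ss' hz Aa hsg).
Qed.

End sampled.

Section opt_risk_deviation.
Context (R : realType) (dS dA dTh : nat) (T : nat) (M : soc R dS dA)
  (Theta : set 'rV[R]_dTh) (f : 'rV[R]_dTh -> R -> R) (rad L LC LTh RTh : R).
Hypotheses (L0 : 0 <= L) (spec : soc_spec M T) (reg : soc_regular M T rad L)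
  (fam : risk_family Theta f T LC LTh RTh).
Variables P Q : forall t, {measure set (borel (noise M t)) -> \bar R}.
Hypothesis PT : forall t, (t < T)%N -> P t setT = 1%E.
Hypothesis QT : forall t, (t < T)%N -> Q t setT = 1%E.

Let LC0 := risk_LC_ge0 fam.

Let value_bounds (W : forall t, {measure set (borel (noise M t)) -> \bar R}) th s :
  (forall t, (t < T)%N -> W t setT = 1%E) -> Theta th -> states M 0 s ->
  risk_lo f T LC th <= value T W (clipped f T th) 0 s 0
    <= risk_lo f T LC th + risk_width T LC.
Proof.
move=> WT Hth Ss; exact: (value_itv spec reg WT LC0 L0
  (fun z => clipped_itv fam z Hth) (fun z z' => clipped_lip fam z z' Hth)
  0 (leq0n T) Ss).
Qed.

Lemma opt_risk_close e s : states M 0 s ->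
  (forall th, Theta th -> `|value T Q (clipped f T th) 0 s 0 -
     value T P (clipped f T th) 0 s 0| <= e) ->
  `|opt_risk T Theta f Q s - opt_risk T Theta f P s| <= e.
Proof.
move=> Ss h; rewrite !(opt_riskE fam spec reg L0)//.
have [m mlo] := risk_lo_bounded fam.
apply: (inf_image_close (m := m)) => //.
- exact: (Theta_neq0 fam).
- move=> th Hth; apply: le_trans (mlo _ Hth) _.
  by case/andP: (value_bounds QT Hth Ss).
- move=> th Hth; apply: le_trans (mlo _ Hth) _.
  by case/andP: (value_bounds PT Hth Ss).
Qed.

Lemma opt_risk_close_width s : states M 0 s ->
  `|opt_risk T Theta f Q s - opt_risk T Theta f P s| <= risk_width T LC.
Proof.
move=> Ss; apply: opt_risk_close => // th Hth.
have := value_bounds QT Hth Ss; have := value_bounds PT Hth Ss.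
rewrite ler_norml; lra.
Qed.

(** Passing to a net parameter costs [e1] under each of the two laws, whence [2 * e1]. *)
Lemma opt_risk_close_net (N : seq 'rV[R]_dTh) e1 e2 s : states M 0 s ->
  (forall th, th \in N -> Theta th) ->
  (forall th, Theta th -> exists2 th', th' \in N & LTh * enorm (th - th') <= e1) ->
  (forall th, th \in N -> `|value T Q (clipped f T th) 0 s 0 -
     value T P (clipped f T th) 0 s 0| <= e2) ->
  `|opt_risk T Theta f Q s - opt_risk T Theta f P s| <= 2 * e1 + e2.
Proof.
move=> Ss NTh Nnet h; apply: opt_risk_close => // th Hth.
have [th' Nth' hth] := Nnet th Hth; have Hth' := NTh _ Nth'.
have cl (W : forall t, {measure set (borel (noise M t)) -> \bar R}) :
    (forall t, (t < T)%N -> W t setT = 1%E) ->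
    `|value T W (clipped f T th) 0 s 0 - value T W (clipped f T th') 0 s 0| <= e1.
  move=> WT; apply: (value_close spec reg WT LC0 L0
    (fun z => clipped_itv fam z Hth) (fun z z' => clipped_lip fam z z' Hth)
    (fun z => clipped_itv fam z Hth') (fun z z' => clipped_lip fam z z' Hth')
    _ _ (add0n T) Ss).
  by move=> z; apply: le_trans hth; exact: (clipped_param fam).
have := h _ Nth'; have := cl _ PT; have := cl _ QT.
rewrite !ler_norml; lra.
Qed.

End opt_risk_deviation.

Theorem theorem3p4 (R : realType) :
  exists2 C : R, 0 < C &
  forall (T dS dA dTh : nat) (M : soc R dS dA)
    (Theta : set 'rV[R]_dTh) (f : 'rV[R]_dTh -> R -> R)
    (rad L LC LTh RTh eps delta : R) (n : nat),
  (0 < T)%N -> (0 < dA)%N -> 0 < L ->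
  soc_spec M T -> soc_regular M T rad L ->
  risk_family Theta f T LC LTh RTh ->
  0 < eps -> 0 < delta < 1 ->
  (0 < n)%N ->
  n%:Z = Num.ceil (C * (T%:R ^+ 3 * LC ^+ 2 / eps ^+ 2)
                   * log_factor T dS dA dTh LC L rad LTh RTh eps delta) ->
  forall (d : measure_display) (Omega : measurableType d)
    (Pr : probability Omega R)
    (xi : forall t, nat -> Omega -> borel (noise M t)),
  iid_samples (noise_law M) T n Pr xi ->
  exists E : set Omega,
    [/\ measurable E, (Pr E >= (1 - delta)%:E)%E &
        forall w s, E w -> states M 0 s ->
        `|opt_risk T Theta f (fun t => empirical R n (fun i => xi t i w)) s
          - opt_risk T Theta f (noise_law M) s| <= eps].
Proof.
(* With [A], [lam] and [kap] as below, [C * A * lam * kap / 2 = 8 * (2 T / (T + 1))^2], which is at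
   least the exponent 8 of [log_factor_exp] because [T >= 1]. *)
have [C [C0 CE]] : exists C : R, 0 < C /\ C = 8 * (16 * 256).
  by eexists; split; last reflexivity; rewrite !mulr_gt0 ?ltr0n.
exists C => // T dS dA dTh M Theta f rad L LC LTh RTh eps delta n.
move=> T0 dA0 L0 spec reg fam eps0 /andP[d0 d1] n0 nE d Omega Pr xi xiP.
have LC0 := risk_LC_ge0 fam.
have PT t : (t < T)%N -> noise_law M t setT = 1%E.
  by move=> _; exact: probability_setT.
have QT w t : (t < T)%N -> empirical R n (fun i => xi t i w) setT = 1%E.
  by move=> _; exact: empirical_setT.
(* If the width is at most [eps] the claim holds surely. Otherwise [eps / B < 1], which yields
   [lam * B <= 1/16] for the [lam] chosen below. *)
have [Bsmall|Bbig] := leP (risk_width T LC) eps.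
  exists setT; split => //; first by rewrite probability_setT lee_fin; lra.
  move=> w s _ Ss; apply: le_trans Bsmall.
  exact: (opt_risk_close_width (ltW L0) spec reg fam PT (QT w) Ss).
pose B := risk_width T LC; rewrite -/B in Bbig.
have B0 : 0 < B by lra.
have Tpos : 0 < T%:R :> R by rewrite ltr0n.
have T1 : 1 <= T%:R :> R by rewrite ler1n.
have LCpos : 0 < LC.
  rewrite lt_neqAle LC0 andbT; apply/eqP => LCE.
  by move: B0; rewrite /B /risk_width -LCE mulr0 mul0r ltxx.
set lf := log_factor _ _ _ _ _ _ _ _ _ _ _ in nE.
(* Each of [2 lam B^2], [T * kap] and [5 T * eta] equals [eps / 8]. With [2 * eps / 8] from the
   parameter net, the total is [5/8 eps]. *)
pose lam := eps / (16 * B ^+ 2); pose kap := eps / (8 * T%:R).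
pose eta := eps / (40 * T%:R).
have lam0 : 0 < lam by rewrite divr_gt0// mulr_gt0// exprn_gt0.
have lamB : lam * B <= 16^-1.
  have -> : lam * B = 16^-1 * (eps / B) by rewrite /lam; field; rewrite gt_eqF.
  by rewrite ler_piMr// ler_pdivrMr// mul1r ltW.
have kap0 : 0 < kap by rewrite divr_gt0// mulr_gt0.
have eta0 : 0 < eta by rewrite divr_gt0// mulr_gt0.
have rad0 := has_radius_ge0 (states_neq0 spec (leq0n T)) (states_radius reg (leq0n T)).
have A0 : 0 < T%:R ^+ 3 * LC ^+ 2 / eps ^+ 2.
  by rewrite divr_gt0 ?exprn_gt0// mulr_gt0 ?exprn_gt0.
set A := T%:R ^+ 3 * LC ^+ 2 / eps ^+ 2 in nE A0.
have nle : C * A * lf <= n%:R.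
  by have := ceil_ge (C * A * lf); rewrite -nE.
(* The ceiling [n] is positive, which forces the logarithmic factor to be positive. *)
have lf0 : 0 <= lf.
  have : 0 < C * A * lf by rewrite -ceil_gt0 -nE ltz_nat.
  by rewrite (pmulr_rgt0 _ (mulr_gt0 C0 A0)) => /ltW.
have expo : 8 * lf <= n%:R * lam * kap / 2.
  apply: (@le_trans _ _ (C * A * lf * lam * kap / 2)); last first.
    by rewrite ler_wpM2r// ler_wpM2r ?(ltW kap0)// ler_wpM2r// ltW.
  have -> : C * A * lf * lam * kap / 2 =
      8 * lf * ((2 * T%:R) ^+ 2 / T.+1%:R ^+ 2).
    rewrite /A /lam /kap /B /risk_width CE; field.
    by rewrite !gt_eqF.
  rewrite ler_peMr ?mulr_ge0// ler_pdivlMr ?exprn_gt0// mul1r.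
  by rewrite lerXn2r ?nnegrE ?mulr_ge0// -natr1; lra.
have [N [NTh Nsize Nnet]] := param_net LTh (Theta_neq0 fam) (Theta_radius fam) eps0.
set p := expR (- (n%:R * lam * kap / 2)).
set bS := 2 * expR 1 * (rad / (eta / (12 * LC * max2 L ^+ (T + 1))) + 2).
set bz := T.+1%:R / (eta / (2 * LC)) + 1.
set bTh := 72 * max2 (LTh * RTh / eps) in Nsize.
have p0 : 0 <= p by exact: expR_ge0.
have bS0 : 0 <= bS.
  have L2 := max2_ge2 L.
  rewrite /bS mulr_ge0 ?mulr_ge0 ?expR_ge0// addr_ge0// divr_ge0//.
  rewrite divr_ge0 ?(ltW eta0)//.
  by rewrite mulr_ge0 ?mulr_ge0// exprn_ge0//; lra.
have bz0 : 0 <= bz.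
  by rewrite addr_ge0// divr_ge0// divr_ge0 ?mulr_ge0// ltW.
have bTh0 : 0 <= bTh by have := max2_ge2 (LTh * RTh / eps); rewrite /bTh; lra.
have good th : th \in N -> mostly Pr (T%:R * (bS ^+ dS * (bS ^+ dA * (bz * (2 * p)))))
   [set w | forall s, states M 0 s ->
      `|value T (fun t => empirical R n (fun i => xi t i w)) (clipped f T th) 0 s 0
        - value T (noise_law M) (clipped f T th) 0 s 0| <=
      2 * lam * B ^+ 2 + T%:R * (kap + 5 * eta)].
  move=> /NTh Hth; exact: (mostly_value_deviation spec reg LCpos (ltW L0)
    (fun z => clipped_itv fam z Hth) (fun z z' => clipped_lip fam z z' Hth)
    n0 xiP kap lam0 lamB eta0).
have q0 : 0 <= T%:R * (bS ^+ dS * (bS ^+ dA * (bz * (2 * p)))).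
  by rewrite !mulr_ge0// exprn_ge0.
have [E [mE PE EA]] := mostly_forall_seq q0 Nsize good.
have PEd : (Pr E <= delta%:E)%E.
  apply: le_trans PE _; rewrite lee_fin.
  have hexp : p <= expR (- (8 * lf)) by rewrite ler_expR lerN2.
  have -> : bTh ^+ dTh * (T%:R * (bS ^+ dS * (bS ^+ dA * (bz * (2 * p))))) =
    (T%:R * (bTh ^+ dTh * (bS ^+ dS * (bS ^+ dA * (bz * 2))))) * p by ring.
  have := @log_factor_exp R T dS dA dTh LC L rad LTh RTh eps delta bS bz bTh
    T0 dA0 eps0 _ bS0 (state_net_base_le L T0 dA0 eps0 LCpos rad0) bz0
    (cost_net_size_le L T0 dA0 eps0 LCpos) bTh0 (param_net_base_le _).
  rewrite d0 d1 => /(_ isT); rewrite -/lf ler_pdivrMr// => h.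
  set X := T%:R * _ in h *.
  have X0 : 0 <= X by rewrite /X !mulr_ge0// exprn_ge0.
  apply: (@le_trans _ _ (expR (8 * lf) * delta * expR (- (8 * lf)))).
    exact: ler_pM.
  by rewrite mulrAC expRxMexpNx_1 mul1r.
exists (~` E); split; first exact: measurableC.
- rewrite probability_setC// EFinB; exact: leeB.
- move=> w s nEw Ss.
  apply: (@le_trans _ _ (2 * (eps / 8) + (2 * lam * B ^+ 2 + T%:R * (kap + 5 * eta)))).
    apply: (opt_risk_close_net (ltW L0) spec reg fam PT (QT w) Ss NTh Nnet) => th Nth.
    exact: (EA w nEw th Nth s Ss).
  have -> : 2 * lam * B ^+ 2 + T%:R * (kap + 5 * eta) = eps * (3 / 8).
    by rewrite /lam /kap /eta; field; rewrite !gt_eqF.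
  lra.
Qed.
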